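(* Let $M=\prod_{\mathcal U}M_i$ be an infinite ultraproduct of finite $\mathcal{L}$-structures in a 1-dimensional asymptotic class such that $T=\operatorname{Th}(M)$ is nowhere trivial, and let $(M,H)=\prod_{\mathcal U}(M_i,H_i)$ be a pseudofinite $H$-structure with $\delta_M(H)=0$. Let $X\subset M^m$ be a non-empty $\mathcal{L}_H$-definable set defined over an $H$-independent tuple $\bar c$. Assume that $\operatorname{SU}(X)=n$ with $n\in\mathbb{N}$. Then $\delta_H(X)\le n$.
   Context: A class $\mathcal{C}$ of finite $\mathcal{L}$-structures is a 1-dimensional asymptotic class if for every $\mathcal{L}$-formula $\varphi(x,\bar y)$ ($x$ a single variable) there are $C>0$ and a finite set $E\subset\mathbb{R}^{>0}$ such that for every $N\in\mathcal{C}$ and $\bar a\in N^{|\bar y|}$, either $|\varphi(N,\bar a)|\le C$ or $\big||\varphi(N,\bar a)|-\mu|N|\big|\le C|N|^{1/2}$ for some $\mu\in E$; and for each $\mu\in E$ there is an $\mathcal{L}$-formula $\varphi_\mu(\bar y)$ without parameters defining in each $N\in\mathcal{C}$ the set of $\bar a$ for which the latter holds with $\mu$. The theory $T$ of an infinite ultraproduct of members of such a class has $SU$-rank 1, hence is geometric (eliminates $\exists^\infty$, and $\mathrm{acl}$ satisfies exchange). In models of $T$, $\dim(\bar a/B)$ is the length of a maximal subtuple of $\bar a$ algebraically independent over $B$; $\bar a\perp_BC$ means $\dim(\bar a/B\cup C)=\dim(\bar a/B)$; $A\perp_B C$ means this for all finite tuples of $A$. $T$ is nowhere trivial if, in a $|T|^+$-saturated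 model, for $|A|\le|T|$ and $p(x)\in S_1(A)$ non-algebraic, for some (equivalently all) $a\models p$ there are finite $\bar b,\bar c$ with $a\perp_A\bar b$, $a\perp_A\bar c$, $a\in\mathrm{acl}(A,\bar b,\bar c)$. $\mathcal{L}_H=\mathcal{L}\cup\{H\}$, $H$ a new unary predicate; $(M,H)$ is an $H$-structure if $H\subseteq M$ is $\mathcal{L}$-algebraically independent and, for every $A\subseteq M$ of finite dimension and every non-algebraic $\mathcal{L}$-type $p(x)\in S_1(A)$, $p$ is realized in $H$ and in $M\setminus\mathrm{acl}(A\cup H)$. A tuple $\bar c$ is $H$-independent if $\bar c\perp_{\bar c\cap H}H$. $T^{ind}$ is the common complete theory of $H$-structures associated with $T$; it is supersimple. $\operatorname{SU}$ is $SU$-rank in $T^{ind}$; $\operatorname{SU}$ of a definable set is the supremum of the $SU$-ranks of types (over its parameters) containing it. For $\mathcal{L}_H$-definable $X=\prod_{\mathcal U}X(M_i)$, $\delta_M(X)=\lim_{i,\mathcal U}\log|X(M_i)|/\log|M_i|$ and $\delta_H(X)=\lim_{i,\mathcal U}\log|X(M_i)|/\log|H_i|$. The existence of such pseudofinite $H$-structures with $\delta_M(H)=0$ is known. *)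

(* Defs.v *)
From mathcomp Require Import all_boot all_order all_algebra finmap.
From mathcomp Require Import all_classical all_reals all_analysis.

Set Implicit Arguments.
Unset Strict Implicit.
Unset Printing Implicit Defensive.

Import Order.TTheory GRing.Theory Num.Theory.
Import numFieldNormedType.Exports.

Local Open Scope classical_set_scope.
Local Open Scope card_scope.
Local Open Scope quotient_scope.
Local Open Scope ring_scope.

Record language := Language {
  Fun : Type; farity : Fun -> nat;
  Rel : Type; rarity : Rel -> nat }.

Arguments farity : clear implicits.
Arguments rarity : clear implicits.

(* [choiceType] is no restriction, by classical choice. *)
Record structure (L : language) := Structure {
  dom :> choiceType;
  dom_nonempty : inhabited dom;
  fint : forall f : Fun L, ('I_(farity L f) -> dom) -> dom;
  rint : forall r : Rel L, ('I_(rarity L r) -> dom) -> Prop }.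

Inductive term (L : language) (n : nat) : Type :=
| Var of 'I_n
| App (f : Fun L) of ('I_(farity L f) -> term L n).

(* [formula L n]: first-order formulas with equality whose free variables are
   among x_0, ..., x_(n-1). [All] binds x_0 of its body, whose remaining
   variables x_1, ..., x_n become x_0, ..., x_(n-1). *)
Inductive formula (L : language) : nat -> Type :=
| Falsum n : formula L n
| Equal n of term L n & term L n : formula L n
| Atom n (r : Rel L) of ('I_(rarity L r) -> term L n) : formula L n
| Imp n of formula L n & formula L n : formula L n
| All n of formula L n.+1 : formula L n.

Definition Neg (L : language) (n : nat) (phi : formula L n) : formula L n :=
  Imp phi (Falsum L n).

Section Semantics.
Variables (L : language) (S : structure L).

Fixpoint eval n (v : 'I_n -> S) (t : term L n) : S :=
  match t with
  | Var i => v i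
  | App f a => fint (fun j => eval v (a j))
  end.

Definition vcons n (x : S) (v : 'I_n -> S) (i : 'I_n.+1) : S :=
  if unlift ord0 i is Some j then v j else x.

Fixpoint sat n (phi : formula L n) : ('I_n -> S) -> Prop :=
  match phi in formula _ n return ('I_n -> S) -> Prop with
  | Falsum _ => fun _ => False
  | Equal _ s t => fun v => eval v s = eval v t
  | Atom _ r a => fun v => rint (fun j => eval v (a j))
  | Imp _ p q => fun v => sat p v -> sat q v
  | All _ p => fun v => forall x, sat p (vcons x v)
  end.

Definition vcat m k (x : 'I_m -> S) (y : 'I_k -> S) (i : 'I_(m + k)) : S :=
  match fintype.split i with inl j => x j | inr j => y j end.

(* the set phi(S, c) defined by the formula phi(x, y) with y := c *)
Definition defset m k (phi : formula L (m + k)) (c : 'I_k -> S) :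
    set ('I_m -> S) := [set x | sat phi (vcat x c)].

Definition theory : set (formula L 0) :=
  [set phi | forall v : 'I_0 -> S, sat phi v].

Definition models (T : set (formula L 0)) : Prop := T `<=` theory.

End Semantics.

Definition elementary (L : language) (S S' : structure L) (e : S -> S') :=
  forall n (phi : formula L n) (v : 'I_n -> S), sat phi v <-> sat phi (e \o v).

Section Types.
Variables (L : language) (S : structure L).
Implicit Types (A B C : set S).

(* a formula in n variables with a tuple of constants of S *)
Record pformula (n : nat) := PFormula {
  pf_size : nat;
  pf_form : formula L (n + pf_size);
  pf_par : 'I_pf_size -> S }.

Arguments pf_form [n] p : rename.
Arguments pf_par [n] p _ : rename.

Definition psol n (psi : pformula n) : set ('I_n -> S) :=
  defset (pf_form psi) (pf_par psi).

Definition has_par A n (psi : pformula n) : Prop := range (pf_par psi) `<=` A.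

Definition pneg n (psi : pformula n) : pformula n :=
  PFormula (Neg (pf_form psi)) (pf_par psi).

(* p \in S_n(A); consistency is finite satisfiability in S *)
Definition complete_type A n (p : set (pformula n)) : Prop :=
  [/\ forall psi, p psi -> has_par A psi,
      forall s : set (pformula n), finite_set s -> s `<=` p ->
        exists x, forall psi, s psi -> psol psi x
    & forall psi, has_par A psi -> p psi \/ p (pneg psi)].

Definition realizes n (x : 'I_n -> S) (p : set (pformula n)) : Prop :=
  forall psi, p psi -> psol psi x.

Definition tup1 (a : S) : 'I_1 -> S := fun=> a.

Definition acl A : set S :=
  [set a | exists psi : pformula 1,
     [/\ has_par A psi, finite_set (psol psi) & psol psi (tup1 a)]].

Definition nonalgebraic (p : set (pformula 1)) : Prop :=
  forall psi, p psi -> infinite_set (psol psi).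

Definition alg_independent A : Prop :=
  forall a, A a -> ~ acl (A `\ a) a.

(* the subtuple (a_i)_(i in s) is algebraically independent over B; repeated
   entries of the tuple count as dependent *)
Definition indep_subtuple B n (a : 'I_n -> S) (s : {set 'I_n}) : Prop :=
  forall i, i \in s ->
    ~ acl (B `|` [set a j | j in [set j | j \in s /\ j != i]]) (a i).

(* dim(a/B); when acl satisfies exchange, all maximal independent subtuples
   have the same length *)
Definition tdim n (a : 'I_n -> S) B : nat :=
  (\max_(s : {set 'I_n} | `[< indep_subtuple B a s >]) #|s|)%N.

Definition perp n (a : 'I_n -> S) B C : Prop := tdim a (B `|` C) = tdim a B.

Definition finite_dim A : Prop :=
  exists d : nat, forall n (a : 'I_n -> S), range a `<=` A ->
    (tdim a set0 <= d)%N.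

(* Here and below T is the ambient theory; its size |T| is taken to be its
   cardinality as a set of sentences. *)

Definition saturated (T : set (formula L 0)) : Prop :=
  forall A, A #<= T -> forall p : set (pformula 1), complete_type A p ->
    exists a, realizes (tup1 a) p.

Definition same_type A k (b c : 'I_k -> S) : Prop :=
  forall psi : pformula k, has_par A psi -> psol psi b <-> psol psi c.

Definition divides A n (psi : pformula n) : Prop :=
  exists (r : nat) (b : nat -> 'I_(pf_size psi) -> S),
    (forall i, same_type A (b i) (pf_par psi)) /\
    (forall s : seq nat, uniq s -> size s = r ->
       ~ exists x, forall i, i \in s -> defset (pf_form psi) (b i) x).

Definition forks A n (psi : pformula n) : Prop :=
  exists (l : nat) (chi : 'I_l -> pformula n),
    (forall j, divides A (chi j)) /\
    (forall x, psol psi x -> exists j, psol (chi j) x).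

(* SU(p) >= k for p \in S_n(A), with S a |T|^+-saturated model of T *)
Fixpoint SU_ge (T : set (formula L 0)) n A (p : set (pformula n)) (k : nat) :
    Prop :=
  if k isn't k'.+1 then True
  else exists (B : set S) (q : set (pformula n)),
    [/\ A `<=` B, B #<= T & complete_type B q] /\
    [/\ p `<=` q, exists2 psi, q psi & forks A psi & SU_ge T B q k'].

(* The ordinal-valued SU-rank, with all ranks >= omega (and the value oo)
   collapsed to +oo. *)
Definition SU (R : realType) T n A (p : set (pformula n)) : \bar R :=
  ereal_sup [set (k%:R : R)%:E | k in [set k | SU_ge T A p k]].

(* SU-rank of the set defined by psi, whose constants lie in A *)
Definition SU_def (R : realType) T n A (psi : pformula n) : \bar R :=
  ereal_sup [set SU R T A p | p in
    [set p : set (pformula n) | complete_type A p /\ p psi]].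

End Types.

(* "In a |T|^+-saturated model": the property does not depend on which. *)
Definition nowhere_trivial (L : language) (T : set (formula L 0)) : Prop :=
  exists S : structure L, [/\ models S T, saturated S T &
    forall A : set S, A #<= T ->
    forall p : set (pformula S 1), complete_type A p -> nonalgebraic p ->
    exists2 a : S, realizes (tup1 a) p &
    exists (k : nat) (b : 'I_k -> S) (l : nat) (c : 'I_l -> S),
      [/\ perp (tup1 a) A (range b), perp (tup1 a) A (range c)
        & acl (A `|` range b `|` range c) a]].

Definition ncard (T : choiceType) (A : set T) : nat := #|` fset_set A|.

Definition near_mu (R : realType) (L : language) (N : structure L) n
    (phi : formula L (1 + n)) (K mu : R) (a : 'I_n -> N) : Prop :=
  `| (ncard (defset phi a))%:R - mu * (ncard [set: N])%:R |
    <= K * Num.sqrt (ncard [set: N])%:R.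

Definition asymptotic_class_1dim (R : realType) (L : language)
    (C : structure L -> Prop) : Prop :=
  (forall N, C N -> finite_set [set: N]) /\
  forall n (phi : formula L (1 + n)),
  exists (K : R) (E : set R),
    [/\ 0 < K, finite_set E & forall mu, E mu -> 0 < mu] /\
    (forall N, C N -> forall a : 'I_n -> N,
       (ncard (defset phi a))%:R <= K \/
       exists2 mu, E mu & near_mu phi K mu a) /\
    (forall mu, E mu -> exists phi_mu : formula L n,
       forall N, C N -> forall a : 'I_n -> N,
         sat phi_mu a <-> near_mu phi K mu a).

Definition lang_H (L : language) : language :=
  Language (farity L) (fun r : option (Rel L) =>
    if r is Some r' then rarity L r' else 1%N).

Section HStructures.
Variable L : language.

Definition expandH (M : structure L) (H : set M) : structure (lang_H L) :=
  @Structure (lang_H L) M (dom_nonempty M) (fun f => @fint L M f)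
    (fun r => match r return ('I_(rarity (lang_H L) r) -> M) -> Prop with
              | Some r' => @rint L M r'
              | None => fun x => H (x ord0)
              end).

Definition reduct (N : structure (lang_H L)) : structure L :=
  @Structure L N (dom_nonempty N) (fun f => @fint (lang_H L) N f)
    (fun r => @rint (lang_H L) N (Some r)).

Definition Hset (N : structure (lang_H L)) : set (reduct N) :=
  [set h | @rint (lang_H L) N None (fun=> h)].

Definition H_structure (N : structure (lang_H L)) : Prop :=
  alg_independent (Hset (N := N)) /\
  forall A : set (reduct N), finite_dim A ->
  forall p : set (pformula (reduct N) 1), complete_type A p ->
    nonalgebraic p ->
    (exists2 h, Hset h & realizes (tup1 h) p) /\
    (exists2 a, ~ acl (A `|` Hset (N := N)) a & realizes (tup1 a) p).

Definition H_independent (N : structure (lang_H L)) k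
    (c : 'I_k -> reduct N) : Prop :=
  perp c (range c `&` Hset (N := N)) (Hset (N := N)).

Definition Tind (T : set (formula L 0)) : set (formula (lang_H L) 0) :=
  [set phi | forall N : structure (lang_H L), H_structure N ->
     models (reduct N) T -> theory N phi].

End HStructures.

Section Ultraproduct.
Variables (I : Type) (U : set_system I) (UU : UltraFilter U).

Section Carrier.
Variable D : I -> choiceType.

Definition ueq (f g : forall i, D i) : bool :=
  `[< \forall i \near U, f i = g i >].

Lemma ueq_refl : reflexive ueq.
Proof. by move=> f; apply/asboolP; exact: nearW. Qed.

Lemma ueq_sym : symmetric ueq.
Proof.
by move=> f g; apply/asboolP/asboolP; apply: filterS => i ->.
Qed.

Lemma ueq_trans : transitive ueq.
Proof.
move=> g f h /asboolP fg /asboolP gh; apply/asboolP.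
by apply: filterS2 fg gh => i -> ->.
Qed.

Definition ueq_equiv : equiv_rel (forall i, D i) :=
  EquivRel ueq ueq_refl ueq_sym ueq_trans.

Definition ucarrier : choiceType := {eq_quot ueq_equiv}.

Definition uclass (f : forall i, D i) : ucarrier :=
  \pi_{eq_quot ueq_equiv} f.

Definition urepr (x : ucarrier) : forall i, D i :=
  repr (x : {eq_quot ueq_equiv}).

Lemma ucarrier_nonempty : (forall i, inhabited (D i)) -> inhabited ucarrier.
Proof.
move=> D0; have D0' i : exists x : D i, True by case: (D0 i) => x; exists x.
by constructor; apply: uclass => i; exact: (sval (cid (D0' i))).
Qed.

End Carrier.

Definition ultraproduct (L : language) (S_ : I -> structure L) : structure L :=
  @Structure L (ucarrier (fun i => dom (S_ i)))
    (ucarrier_nonempty (fun i => dom_nonempty (S_ i)))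
    (fun f x => uclass (fun i => fint (fun j => urepr (x j) i)))
    (fun r x => \forall i \near U, rint (fun j => urepr (x j) i)).

(* lim_U log a_i / log b_i, which exists in \bar R by compactness; ln 0 = 0 is
   harmless since a definable set X is non-empty iff U-almost all X(M_i) are *)
Definition delta (R : realType) (a b : I -> nat) : \bar R :=
  lim ((ln ((a i)%:R : R) / ln ((b i)%:R : R))%:E @[i --> U]).

End Ultraproduct.

(* Main.v *)
Require Import Defs.
From mathcomp Require Import all_boot all_order all_algebra.
From mathcomp Require Import all_classical all_reals all_analysis.
From mathcomp Require Import ring lra.
From Stdlib Require List.

Set Implicit Arguments.
Unset Strict Implicit.
Unset Printing Implicit Defensive.

Local Open Scope classical_set_scope.
Local Open Scope card_scope.
Local Open Scope ring_scope.

(** The algebraic closure [acl] of the language L is a pregeometry in every model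
    of the theory of [M]: in a one-dimensional asymptotic class a definable set is
    either bounded or a positive proportion of the structure, and double counting
    turns this dichotomy into exchange ([class_gap], [class_exchange]).  It also
    gives a first-order meaning to having infinitely many solutions
    ([class_large]), so that the density and extension properties of H-structures
    are first-order schemes; they hold in [MH] and therefore in the saturated
    extension [S].

    The theorem follows from a covering: every solution [x] of [phi(-, c)] in [S]
    has all its coordinates in the closure of [c] and of at most [n] elements of
    [H] ([solution_algebraic]).  By saturation finitely many algebraic formulas
    witness this for all solutions ([solutions_covered]).  The elementary map and
    Los's theorem carry the resulting sentence to almost all finite structures,
    where it gives |X_i| <= K * |H_i| ^ n.  Since |H_i| tends to infinity along the
    ultrafilter, the constant K disappears in the quotient of the logarithms.

    The covering is a lower bound for the SU-rank.  Over a base [b] from which [H]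
    stays independent, a tuple in the closure of [b] and [H] has a least support
    in [H] ([support_exists]).  Each element h of the support is algebraic over
    the tuple and [b] in the language with [H], but h has infinitely many
    conjugates over [b].  Hence adding h to the base makes the type of the tuple
    fork ([support_forks]), and the SU-rank is at least the size of the support
    ([SU_ge_support]).  The conjugates come from a back-and-forth argument: H-free
    tuples with the same L-type that meet [H] in the same places have the same
    type ([twins_sat]).

    It remains to exclude a solution with a coordinate a outside the closure of
    [c] and [H].  Nowhere triviality provides a base, an element h of [H] and an
    element g, generic over the base and [H], such that a, h and g depend on each
    other as if a = h + g ([generic_step]).  Decomposing g in the same way and
    repeating, a acquires over a larger base a support of any prescribed size
    ([generic_support]), so that its SU-rank exceeds every integer. *)

(** * Pregeometries *)

Record pregeometry (T : choiceType) (cl : set T -> set T) : Prop := {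
  cl_sub : forall A, A `<=` cl A;
  cl_trans : forall A B, A `<=` cl B -> cl A `<=` cl B;
  cl_fin : forall A x, cl A x ->
    exists2 s : seq T, [set` s] `<=` A & cl [set` s] x;
  cl_exchange : forall A x y, cl (y |` A) x -> ~ cl A x -> cl (x |` A) y }.

Section Pregeometry.
Variables (T : choiceType) (cl : set T -> set T) (clP : pregeometry cl).
Variable H : set T.
Implicit Types (A B F Y : set T) (s t : seq T) (h x y : T).

Lemma cl_mono A B : A `<=` B -> cl A `<=` cl B.
Proof. by move=> AB; apply: (cl_trans clP) => x /AB; apply: (cl_sub clP). Qed.

(** Exchange for a finite set: apply it to the first element of [t] without which
    the dependence fails. *)
Lemma cl_exchange_seq A t x : cl (A `|` [set` t]) x -> ~ cl A x ->
  exists2 y, y \in t & cl (x |` A `|` [set` t] `\ y) y.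
Proof.
move=> + nAx; elim: t => [|y t IHt] clx.
  by case: nAx; apply: cl_mono clx => z [].
have t_sub z : z \in t -> z \in y :: t by rewrite inE orbC => ->.
have [/IHt[z zt clz]|ntx] := pselect (cl (A `|` [set` t]) x).
  exists z; first exact: t_sub.
  by apply: cl_mono clz => u [?|[/t_sub ut uz]]; [left|right].
exists y; first exact: mem_head.
have nty : y \notin t.
  apply/negP => yt; apply: ntx; apply: cl_mono clx => z [?|]; first by left.
  by rewrite /= inE => /orP[/eqP->|]; right.
have : cl (x |` (A `|` [set` t])) y.
  apply: (cl_exchange clP) ntx; apply: cl_mono clx => z [?|]; first by right; left.
  by rewrite /= inE => /orP[/eqP->|]; [left|right; right].
apply: cl_mono => z [->|[?|zt]]; [by left; left|by left; right|right].
by split; [exact: t_sub|move=> zy; rewrite -zy zt in nty].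
Qed.

Lemma cl_first A t x : ~ cl A x -> cl (A `|` [set` t]) x ->
  exists (t' : seq T) y, [/\ [set` t'] `<=` [set` t], y \in t,
    ~ cl (A `|` [set` t']) x & cl (y |` (A `|` [set` t'])) x].
Proof.
move=> nAx; elim: t => [|y t IHt] clx.
  by case: nAx; apply: cl_mono clx => z [].
have t_sub z : z \in t -> z \in y :: t by rewrite inE orbC => ->.
have [/IHt[t' [z [t't zt nt' clz]]]|ntx] := pselect (cl (A `|` [set` t]) x).
  by exists t', z; split=> //; [move=> u /t't /t_sub|exact: t_sub].
exists t, y; split=> //; first exact: mem_head.
apply: cl_mono clx => z [?|]; first by right; left.
by rewrite /= inE => /orP[/eqP->|]; [left|right; right].
Qed.

(** Shorten [t], and then [s], to a part that is just too small to generate [x]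
    with the rest: one element of each is isolated, and the parts that remain
    go into the base. *)
Lemma cl_nontrivial A s t x : ~ cl (A `|` [set` s]) x -> ~ cl (A `|` [set` t]) x ->
  cl (A `|` [set` s] `|` [set` t]) x ->
  exists (d : seq T) y z, [/\ ~ cl (y |` (A `|` [set` d])) x,
    ~ cl (z |` (A `|` [set` d])) x & cl (y |` (z |` (A `|` [set` d]))) x].
Proof.
move=> nsx ntx stx; have [t' [z [t't zt nst'x zst'x]]] := cl_first nsx stx.
have nzt'x : ~ cl (z |` (A `|` [set` t'])) x.
  apply: contra_not ntx; apply: cl_mono => u [->|[?|/t't ?]]; by [right|left|right].
have [|s' [y [s's ys nx clx]]] := cl_first nzt'x (t := s).
  apply: cl_mono zst'x => u [->|[[?|?]|?]]; first by left; left.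
  - by left; right; left.
  - by right.
  - by left; right; right.
have dE : [set` s' ++ t'] = [set` s'] `|` [set` t'].
  by apply/seteqP; split=> u; rewrite /= mem_cat => /orP.
exists (s' ++ t'), y, z; rewrite dE; split.
- apply: contra_not nst'x; apply: cl_mono => u [->|[?|[/s's ?|?]]].
  + by left; right.
  + by left; left.
  + by left; right.
  + by right.
- apply: contra_not nx; apply: cl_mono => u [->|[?|[?|?]]].
  + by left; left.
  + by left; right; left.
  + by right.
  + by left; right; right.
- apply: cl_mono clx => u [->|[[->|[?|?]]|?]].
  + by left.
  + by right; left.
  + by right; right; left.
  + by right; right; right; right.
  + by right; right; right; left.
Qed.

(** The base [B] leaves the part of [H] outside [B] independent.  For a finite
    tuple this is H-independence, see [perp_Hfree]. *)
Definition Hfree B := forall h, H h -> ~ B h -> ~ cl (B `|` H `\ h) h.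

Lemma Hfree_setU1H B h : Hfree B -> H h -> Hfree (h |` B).
Proof.
move=> HB Hh x Hx nBx; have nxh : x <> h by move=> xh; apply: nBx; left.
have nBx' : ~ B x by move=> Bx; apply: nBx; right.
move=> /(cl_mono (B := B `|` H `\ x)) clx; apply: (HB x Hx nBx'); apply: clx.
by move=> y [[->|By]|?]; [right; split=> // hx; apply: nxh|left|right].
Qed.

Lemma Hfree_setU1_cl B x : Hfree B -> cl B x -> Hfree (x |` B).
Proof.
move=> HB clx h Hh nBh clh; have nBh' : ~ B h by move=> Bh; apply: nBh; right.
apply: (HB h Hh nBh'); apply: (cl_trans clP _ clh) => y [[->|By]|Hy].
- by apply: cl_mono clx => z Bz; left.
- by apply: (cl_sub clP); left.
- by apply: (cl_sub clP); right.
Qed.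

Lemma Hfree_setU1_generic B x : Hfree B -> ~ cl (B `|` H) x -> Hfree (x |` B).
Proof.
move=> HB gx h Hh nBh clh; have nBh' : ~ B h by move=> Bh; apply: nBh; right.
apply: gx; apply: cl_mono (cl_exchange clP (A := B `|` H `\ h) _ (HB h Hh nBh')).
  by move=> y [->|[By|[Hy _]]]; [right|left|right].
by rewrite setUA.
Qed.

Lemma Hfree_cl B h : Hfree B -> H h -> cl B h -> B h.
Proof.
move=> HB Hh clh; apply: contrapT => nBh; apply: (HB h Hh nBh).
by apply: cl_mono clh => y; left.
Qed.

(** Over a free base, what lies in the closures of two subsets of [H] already
    lies in the closure of their intersection: an element of the first subset
    that is outside the second one and really needed would, by exchange, depend
    on the rest of [H]. *)
Lemma Hfree_cap B s F x : Hfree B -> [set` s] `<=` H -> F `<=` H ->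
  cl (B `|` [set` s]) x -> cl (B `|` F) x -> cl (B `|` [set` s] `&` F) x.
Proof.
move=> HB sH FH cls clF; set F1 := [set` s] `&` F.
suff drop_s2 s2 : [set` s2] `<=` H `\` F -> cl (B `|` F1 `|` [set` s2]) x ->
    cl (B `|` F1) x.
  apply: (drop_s2 [seq h <- s | `[< ~ F h >]]) => [h|].
    by rewrite /= mem_filter => /andP[/asboolP nFh hs]; split=> //; apply: sH.
  apply: cl_mono cls => h [Bh|hs]; first by left; left.
  have [Fh|nFh] := pselect (F h); first by left; right.
  by right; rewrite /= mem_filter hs andbT; apply/asboolP.
elim: s2 => [|h s2 IHs2] s2H cl2.
  by apply: cl_mono cl2 => z [|].
have {}IHs2 : cl (B `|` F1 `|` [set` s2]) x -> cl (B `|` F1) x.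
  by apply: IHs2 => z zs2; apply: s2H; rewrite /= inE zs2 orbT.
have [Hh nFh] : (H `\` F) h by apply: s2H; rewrite /= mem_head.
have drop_h : h \in s2 \/ B h -> cl (B `|` F1) x.
  move=> hs2B; apply: IHs2; apply: cl_mono cl2 => z [?|]; first by left.
  rewrite /= inE => /orP[/eqP->|]; last by right.
  by case: hs2B => ?; [right|left; left].
have [hs2|nhs2] := pselect (h \in s2); first by apply: drop_h; left.
have [Bh|nBh] := pselect (B h); first by apply: drop_h; right.
apply: IHs2; apply: contrapT => nclx; apply: (HB h Hh nBh).
have clh : cl (x |` (B `|` F1 `|` [set` s2])) h.
  apply: (cl_exchange clP) => //; apply: cl_mono cl2 => z [?|].
    by right; left.
  by rewrite /= inE => /orP[/eqP->|]; [left|right; right].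
apply: (cl_trans clP _ clh) => z [->|[[Bz|[zs Fz]]|zs2]].
- apply: cl_mono clF => y [By|Fy]; [by left|right; split; first exact: FH].
  by move=> yh; apply: nFh; rewrite -yh.
- by apply: (cl_sub clP); left.
- apply: (cl_sub clP); right; split; first exact: FH.
  by move=> zh; apply: nFh; rewrite -zh.
- apply: (cl_sub clP); right; split.
    by have [] : (H `\` F) z by apply: s2H; rewrite /= inE zs2 orbT.
  by move=> zh; apply: nhs2; rewrite -zh.
Qed.

(** The support of [Y] over a free base: the least subset of [H] that generates
    [Y], listed without repetition (the H-basis of the literature). *)
Definition is_support B Y s :=
  [/\ uniq s, [set` s] `<=` H, Y `<=` cl (B `|` [set` s])
    & forall F, F `<=` H -> Y `<=` cl (B `|` F) -> [set` s] `<=` F].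

(** Finite character, applied to each of the finitely many elements of [ys]. *)
Lemma cl_finset B F (ys : seq T) : [set` ys] `<=` cl (B `|` F) ->
  exists2 s : seq T, [set` s] `<=` F & [set` ys] `<=` cl (B `|` [set` s]).
Proof.
elim: ys => [|y ys IHys] clys; first by exists [::].
have [|s sF cls] := IHys.
  by move=> z zys; apply: clys; rewrite /= inE zys orbT.
have /(cl_fin clP)[t tBF clt] : cl (B `|` F) y by apply: clys; exact: mem_head.
exists ([seq z <- t | `[< F z >]] ++ s) => z.
  by rewrite /= mem_cat mem_filter => /orP[/andP[/asboolP]|/sF].
rewrite /= inE => /orP[/eqP->|zys].
  apply: cl_mono clt => u ut; have [Bu|Fu] := tBF u ut; first by left.
  by right; rewrite /= mem_cat mem_filter ut andbT; apply/orP; left; apply/asboolP.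
apply: cl_mono (cls z zys) => u [Bu|us]; first by left.
by right; rewrite /= mem_cat us orbT.
Qed.

(** A set [s] of least size that generates [ys] is contained in every other
    generating set [F]: by [Hfree_cap] its intersection with [F] still generates
    [ys]. *)
Lemma support_exists B (ys : seq T) : Hfree B ->
  [set` ys] `<=` cl (B `|` H) -> exists s, is_support B [set` ys] s.
Proof.
move=> HB /cl_finset[s0 s0H cls0].
pose P n := `[< exists s : seq T, [/\ size s = n, [set` s] `<=` H &
                             [set` ys] `<=` cl (B `|` [set` s])] >].
have exP : exists n, P n by exists (size s0); apply/asboolP; exists s0.
case: (ex_minnP exP) => _ /asboolP[s [<- sH cls]] min_size.
have min_s t : [set` t] `<=` H -> [set` ys] `<=` cl (B `|` [set` t]) ->
    (size s <= size t)%N.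
  by move=> tH clt; apply: min_size; apply/asboolP; exists t.
have in_undup : [set` undup s] = [set` s].
  by apply/seteqP; split=> z; rewrite /= mem_undup.
exists s; split=> // [|F FH clF].
  by rewrite -[uniq s]negbK -ltn_size_undup -leqNgt min_s ?in_undup.
have capE : [set` [seq z <- s | `[< F z >]]] = [set` s] `&` F.
  apply/seteqP; split=> z; rewrite /= mem_filter.
    by move=> /andP[/asboolP].
  by case=> zs /asboolP ->.
have := min_s [seq z <- s | `[< F z >]]; rewrite capE size_filter => le_s.
have /allP sF : all (fun z => `[< F z >]) s.
  rewrite all_count eqn_leq count_size le_s // => [z [/sH]//|y ys_y].
  exact: Hfree_cap (cls y ys_y) (clF y ys_y).
by move=> z /sF /asboolP.
Qed.

Lemma support_behead B Y h s :
  is_support B Y (h :: s) -> is_support (h |` B) Y s.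
Proof.
move=> [/andP[nhs us] hsH Yhs min_hs]; split=> //.
- by move=> z zs; apply: hsH; rewrite /= inE zs orbT.
- move=> y /Yhs; apply: cl_mono => z [Bz|]; first by left; right.
  by rewrite /= inE => /orP[/eqP->|]; [left; left|right].
- move=> F FH YF z zs.
  have : [set` h :: s] `<=` h |` F.
    apply: min_hs => [u [->|/FH//]|y /YF].
      by apply: hsH; rewrite /= mem_head.
    by apply: cl_mono => u [[->|Bu]|Fu]; [right; left|left|right; right].
  case/(_ z) => [|zh|//]; first by rewrite /= inE zs orbT.
  by rewrite -zh zs in nhs.
Qed.

(** An element of [B] can be dropped from a generating set, hence does not belong
    to the least one. *)
Lemma support_notin B Y s h : is_support B Y s -> h \in s -> ~ B h.
Proof.
move=> [_ sH Ys min_s] hs Bh; have [_] : (H `\ h) h; last exact.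
suff: [set` s] `<=` [set` s] `\ h by move=> /(_ h hs)[/sH].
apply: min_s => [z [/sH]//|y /Ys]; apply: cl_mono => z [Bz|zs]; first by left.
by have [->|/eqP zh] := eqVneq z h; [left|right].
Qed.

End Pregeometry.

(** * First-order formulas *)

(** A renaming of variables, carried under a quantifier. *)
Definition up n m (f : 'I_n -> 'I_m) (i : 'I_n.+1) : 'I_m.+1 :=
  if unlift ord0 i is Some j then lift ord0 (f j) else ord0.

Section Syntax.
Variable L : language.

Fixpoint ren_term n m (f : 'I_n -> 'I_m) (t : term L n) : term L m :=
  match t with
  | Var i => Var L (f i)
  | App g a => App (fun j => ren_term f (a j))
  end.

Fixpoint ren n (phi : formula L n) : forall m, ('I_n -> 'I_m) -> formula L m :=
  match phi in formula _ n return forall m, ('I_n -> 'I_m) -> formula L m with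
  | Falsum _ => fun m _ => Falsum L m
  | Equal _ s t => fun m f => Equal (ren_term f s) (ren_term f t)
  | Atom _ r a => fun m f => Atom (fun j => ren_term f (a j))
  | Imp _ p q => fun m f => Imp (ren p f) (ren q f)
  | All _ p => fun m f => All (ren p (up f))
  end.

Definition And n (p q : formula L n) := Neg (Imp p (Neg q)).
Definition Ex n (p : formula L n.+1) := Neg (All (Neg p)).
Definition Conj n (l : seq (formula L n)) := foldr (@And n) (Neg (Falsum L n)) l.

Fixpoint ExN m n : formula L (m + n) -> formula L n :=
  match m return formula L (m + n) -> formula L n with
  | 0 => id
  | m'.+1 => fun p => ExN (m := m') (Ex p)
  end.

(** Counting by removal: there are at most [N'.+1] solutions when some [y] leaves
    at most [N'] solutions different from [y]. *)
Fixpoint AtMost N n (p : formula L n.+1) : formula L n :=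
  if N isn't N'.+1 then All (Neg p)
  else Ex (AtMost N' (And (ren p (up (lift ord0)))
                          (Neg (Equal (Var L ord0) (Var L (lift ord0 ord0)))))).

End Syntax.

Definition atmost (T : choiceType) N (P : set T) :=
  exists2 s : seq T, (size s <= N)%N & forall x, P x -> x \in s.

Section Sat.
Variables (L : language) (S : structure L).

Lemma vcons0 n x (v : 'I_n -> S) : vcons x v ord0 = x.
Proof. by rewrite /vcons unlift_none. Qed.

Lemma vconsS n x (v : 'I_n -> S) i : vcons x v (lift ord0 i) = v i.
Proof. by rewrite /vcons liftK. Qed.

Lemma vcons_tail n x (v : 'I_n -> S) : vcons x v \o lift ord0 = v.
Proof. by apply/funext => i /=; rewrite vconsS. Qed.

Lemma vcons_eta n (v : 'I_n.+1 -> S) : vcons (v ord0) (v \o lift ord0) = v.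
Proof.
by apply/funext => i; rewrite /vcons; case: (unliftP ord0 i) => [j|] ->.
Qed.

Lemma vcons_up n m (f : 'I_n -> 'I_m) x (v : 'I_m -> S) :
  vcons x v \o up f = vcons x (v \o f).
Proof.
apply/funext => i; rewrite /= /up /vcons; case: (unliftP ord0 i) => [j|] _.
  by rewrite liftK.
by rewrite unlift_none.
Qed.

Lemma eval_ren n m (f : 'I_n -> 'I_m) (v : 'I_m -> S) (t : term L n) :
  Defs.eval v (ren_term f t) = Defs.eval (v \o f) t.
Proof. by elim: t => //= g a IHa; congr fint; apply/funext. Qed.

Lemma sat_ren n (phi : formula L n) m (f : 'I_n -> 'I_m) (v : 'I_m -> S) :
  sat (ren phi f) v = sat phi (v \o f).
Proof.
elim: phi m f v => [|? s t|? r a|? p IHp q IHq|? p IHp] m f v //=.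
- by rewrite !eval_ren.
- by under eq_fun do rewrite eval_ren.
- by rewrite IHp IHq.
- by apply: eq_forall => x; rewrite IHp vcons_up.
Qed.

Lemma satNeg n (p : formula L n) (v : 'I_n -> S) : sat (Neg p) v = ~ sat p v.
Proof. by []. Qed.

Lemma satImp n (p q : formula L n) (v : 'I_n -> S) :
  sat (Imp p q) v = (sat p v -> sat q v).
Proof. by []. Qed.

Lemma satAnd n (p q : formula L n) (v : 'I_n -> S) :
  sat (And p q) v = (sat p v /\ sat q v).
Proof.
apply/propext; split=> [h|[pv qv] h]; last exact: h.
by split; apply: contrapT => nv; apply: h => // ? ?.
Qed.

Lemma satEx n (p : formula L n.+1) (v : 'I_n -> S) :
  sat (Ex p) v = exists x, sat p (vcons x v).
Proof.
rewrite /=; apply/propext; split=> [/existsNP[x /contrapT]|[x px] h]; first by exists x.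
exact: (h x).
Qed.

Lemma satConj n (l : seq (formula L n)) (v : 'I_n -> S) :
  sat (Conj l) v = List.Forall (fun p => sat p v) l.
Proof.
elim: l => [|p l IHl]; first by apply/propext; split=> [_|_ []]; constructor.
rewrite -[Conj _]/(And p (Conj l)) satAnd IHl.
apply/propext; split=> [[]|h]; first by constructor.
by inversion h.
Qed.

Lemma vcat_vcons m n (x : S) (w : 'I_m -> S) (v : 'I_n -> S) :
  vcat (vcons x w) v = vcons x (vcat w v) :> ('I_(m.+1 + n) -> S).
Proof.
apply/funext => i; rewrite /vcat /vcons.
case: unliftP => [j ->|->]; last first.
  case: splitP => [j /esym/eqP|//]; case: unliftP => //= j' -> //.
have -> : lift ord0 j = unsplit (match fintype.split j with
    inl k => inl (lift ord0 k) | inr k => inr k end).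
  by apply/val_inj; case: splitP => k /= ->.
rewrite unsplitK; case: splitP => k _ //; first by rewrite liftK.
Qed.

Lemma vcat0 n (w : 'I_0 -> S) (v : 'I_n -> S) : vcat w v = v.
Proof.
apply/funext => i; rewrite /vcat; case: splitP => [[]//|j ij].
by congr v; apply/val_inj.
Qed.

Lemma vcat1 n (w : 'I_1 -> S) (v : 'I_n -> S) : vcat w v = vcons (w ord0) v.
Proof. by rewrite -[in LHS](vcons_eta w) vcat_vcons vcat0. Qed.

Lemma satExN m n (p : formula L (m + n)) (v : 'I_n -> S) :
  sat (ExN p) v = exists w : 'I_m -> S, sat p (vcat w v).
Proof.
elim: m p => [|m IHm] p.
  apply/propext; split=> [pv|[w]]; last by rewrite vcat0.
  by exists (fun i => v (widen_ord (leq0n n) i)); rewrite vcat0.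
rewrite [ExN _]/= IHm; apply/propext; split.
  move=> [w]; rewrite satEx => -[x pxw]; exists (vcons x w).
  by rewrite vcat_vcons.
move=> [w pw]; exists (w \o lift ord0); rewrite satEx; exists (w ord0).
by rewrite -vcat_vcons vcons_eta.
Qed.

Lemma satAtMost N n (p : formula L n.+1) (v : 'I_n -> S) :
  sat (AtMost N p) v = atmost N [set x | sat p (vcons x v)].
Proof.
elim: N n p v => [|N IHN] n p v.
  apply/propext; split=> [np|[[|//] _ h x /h]//].
  by exists [::] => // x /np.
rewrite [AtMost _ _]/= satEx; apply/propext; split.
  move=> [y]; rewrite IHN => -[s sN hs]; exists (y :: s) => // x px.
  rewrite inE; have [//|/eqP xy /=] := eqVneq x y; apply: hs.
  rewrite /mkset satAnd sat_ren vcons_up; split.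
    by congr sat: px; congr vcons; apply/funext => i; rewrite /= vconsS.
  by rewrite satNeg /= vcons0 vconsS vcons0.
move=> [s sN hs]; have [x0] := dom_nonempty S.
exists (head x0 s); rewrite IHN; exists (behead s).
  by rewrite size_behead; case: (s) sN.
move=> x; rewrite /mkset satAnd sat_ren vcons_up => -[px].
rewrite satNeg /= vcons0 vconsS vcons0 => xs; have : x \in s.
  apply: hs; congr sat: px; congr vcons; apply/funext => i; rewrite /= vconsS //.
by case: (s) xs => //= y t xy; rewrite inE => /orP[/eqP|].
Qed.

End Sat.

(** * Ultraproducts *)

Section Los.
Variables (I : Type) (U : set_system I) (UU : UltraFilter U).
Local Open Scope quotient_scope.

Lemma uclassP (D : I -> choiceType) (f g : forall i, D i) :
  uclass UU f = uclass UU g <-> \forall i \near U, f i = g i.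
Proof. by split=> [/eqmodP/asboolP|fg]; last exact/eqmodP/asboolP. Qed.

Lemma ureprK (D : I -> choiceType) (x : ucarrier UU D) : uclass UU (urepr x) = x.
Proof. exact: reprK. Qed.

Lemma urepr_uclass (D : I -> choiceType) (f : forall i, D i) :
  \forall i \near U, urepr (uclass UU f) i = f i.
Proof. by apply/uclassP; rewrite ureprK. Qed.

Variables (L : language) (S_ : I -> structure L).

Lemma eval_ultraproduct n (v : 'I_n -> forall i, S_ i) (t : term L n) :
  Defs.eval (fun j => uclass UU (v j) : ultraproduct UU S_) t =
  uclass UU (fun i => Defs.eval (fun j => v j i) t).
Proof.
elim: t => //= g a IHa; apply/uclassP.
have : \forall i \near U, forall j, urepr (uclass UU
    (fun i => Defs.eval (fun k => v k i) (a j))) i = Defs.eval (fun k => v k i) (a j).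
  by apply: filter_forall => j; exact: urepr_uclass.
apply: filterS => i h; congr fint; apply/funext => j; by rewrite IHa h.
Qed.

(** Los's theorem.  For a quantifier, a counterexample is chosen in every index
    where there is one; negations are decided by the ultrafilter. *)
Lemma sat_ultraproduct n (phi : formula L n) (v : 'I_n -> forall i, S_ i) :
  sat phi (fun j => uclass UU (v j) : ultraproduct UU S_) <->
  \forall i \near U, sat phi (fun j => v j i).
Proof.
elim: phi v => [?|? s t|? r a|? p IHp q IHq|? p IHp] v /=.
- by split=> // /filter_ex[].
- by rewrite !eval_ultraproduct; exact: uclassP.
- have ev : \forall i \near U, forall j, urepr (Defs.eval
      (fun k => uclass UU (v k) : ultraproduct UU S_) (a j)) i =
      Defs.eval (fun k => v k i) (a j).
    by apply: filter_forall => j; rewrite eval_ultraproduct; exact: urepr_uclass.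
  by split; apply: filterS2 ev => i /funext ->.
- split=> [pq|pq /IHp pv]; last first.
    by apply/IHq; apply: filterS2 pq pv => i; apply.
  have [pv|npv] := in_ultra_setVsetC [set i | sat p (fun j => v j i)] UU.
    by have /IHq := pq ((IHp _).2 pv); apply: filterS => i qv _.
  by apply: filterS npv => i npi /npi.
- have vE x f : x = uclass UU f ->
      vcons (x : ultraproduct UU S_) (fun j => uclass UU (v j)) =
      fun j => uclass UU ((fun k => if unlift ord0 k is Some j then v j else f) j).
    by move=> ->; apply/funext => j; rewrite /vcons; case: unlift.
  have vE' f i : (fun j => (if unlift ord0 j is Some k then v k else f) i) =
      vcons (f i) (fun j => v j i).
    by apply/funext => j; rewrite /vcons; case: unlift.
  split=> [pv|pv x]; last first.
    rewrite (vE x (urepr x)) ?ureprK//; apply/IHp; apply: filterS pv => i.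
    by rewrite vE'.
  pose P i x := ~ sat p (vcons x (fun j => v j i)).
  have wit i : exists x, P i x \/ forall y, ~ P i y.
    have [[x Px]|nP] := pselect (exists x, P i x); first by exists x; left.
    by have [x] := dom_nonempty (S_ i); exists x; right=> y Py; apply: nP; exists y.
  have := pv (uclass UU (fun i => sval (cid (wit i)))).
  rewrite (vE _ _ erefl) => /IHp; apply: filterS => i; rewrite vE'.
  case: (svalP (cid (wit i))) => [nP /nP//|nP _ x]; apply: contrapT; exact: nP.
Qed.

End Los.

(** * The language with H *)

Section Lift.
Variable L : language.

Fixpoint lift_term n (t : term L n) : term (lang_H L) n :=
  match t with
  | Var i => Var (lang_H L) i
  | App g a => @App (lang_H L) n g (fun j => lift_term (a j))
  end.

Fixpoint lift_form n (phi : formula L n) : formula (lang_H L) n :=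
  match phi with
  | Falsum n => Falsum (lang_H L) n
  | Equal _ s t => Equal (lift_term s) (lift_term t)
  | Atom _ r a => @Atom (lang_H L) _ (Some r) (fun j => lift_term (a j))
  | Imp _ p q => Imp (lift_form p) (lift_form q)
  | All _ p => All (lift_form p)
  end.

Definition InH n (i : 'I_n) : formula (lang_H L) n :=
  @Atom (lang_H L) n None (fun=> Var (lang_H L) i).

Variable S : structure (lang_H L).

Lemma eval_lift n (v : 'I_n -> S) (t : term L n) :
  Defs.eval v (lift_term t) = @Defs.eval L (reduct S) n v t.
Proof. by elim: t => //= g a IHa; congr fint; apply/funext. Qed.

Lemma sat_lift n (phi : formula L n) (v : 'I_n -> S) :
  sat (lift_form phi) v = @sat L (reduct S) n phi v.
Proof.
elim: phi v => [|? s t|? r a|? p IHp q IHq|? p IHp] v //=.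
- by rewrite !eval_lift.
- by under eq_fun do rewrite eval_lift.
- by rewrite IHp IHq.
- by apply: eq_forall => x; exact: IHp.
Qed.

Lemma sat_InH n (i : 'I_n) (v : 'I_n -> S) : sat (InH i) v = Hset (v i).
Proof. by []. Qed.

End Lift.

Arguments pf_par {L S n} p _ : rename.

(* Formulas are unfolded only through the [sat] lemmas. *)
Arguments sat : simpl never.

(** * Algebraic closure *)

Section Counting.
Variable T : choiceType.
Implicit Types (P : set T) (N : nat).

Lemma atmostW N P Q : P `<=` Q -> atmost N Q -> atmost N P.
Proof. by move=> PQ [s sN Qs]; exists s => // x /PQ /Qs. Qed.

Lemma finite_atmost P : finite_set P <-> exists N, atmost N P.
Proof.
split=> [/finite_seqP[s ->]|[N [s _ Ps]]]; first by exists (size s); exists s => // x.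
by apply: (@sub_finite_set _ _ [set` s]) => [x /Ps//|]; exact: finite_seq.
Qed.

Lemma atmost_bigcup (A : choiceType) N1 N2 P (Q : T -> set A) :
  atmost N1 P -> (forall y, P y -> atmost N2 (Q y)) ->
  atmost (N1 * N2) [set x | exists2 y, P y & Q y x].
Proof.
move=> [s sN1 Ps] PQ.
have PQ' y : exists t : seq A, (size t <= N2)%N /\ (P y -> forall x, Q y x -> x \in t).
  have [/PQ[t tN Qt]|nP] := pselect (P y); first by exists t; split=> // _.
  by exists [::].
pose f y := sval (cid (PQ' y)).
have fN y : (size (f y) <= N2)%N by rewrite /f; case: cid => t [] /=.
have fP y x : P y -> Q y x -> x \in f y by rewrite /f; case: cid => t [_ h] /= /h; apply.
exists (flatten (map f s)) => [|x [y Py /(fP y x Py) xf]].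
  rewrite (leq_trans _ (leq_mul sN1 (leqnn N2)))//.
  elim: (s) => //= y t IHt; rewrite size_cat mulSn.
  by rewrite leq_add.
by apply/flattenP; exists (f y) => //; apply: map_f; exact: Ps.
Qed.

End Counting.

Definition seq_tuple (T : choiceType) (s : seq T) : 'I_(size s) -> T :=
  tnth (in_tuple s).
Arguments seq_tuple {T} s _.

Section TupleRanges.
Variable T : choiceType.

Lemma range_seq_tuple (s : seq T) : range (seq_tuple s) = [set` s].
Proof.
apply/seteqP; split=> x /=; first by move=> [i _ <-]; exact: mem_tnth.
by move=> /(tnthP (in_tuple s))[i ->]; exists i.
Qed.

Definition tuple_seq n (v : 'I_n -> T) := [seq v i | i <- enum 'I_n].

Lemma set_tuple_seq n (v : 'I_n -> T) : [set` tuple_seq v] = range v.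
Proof.
apply/seteqP; split=> x /=; first by move=> /mapP[i _ ->]; exists i.
by move=> [i _ <-]; apply: map_f; rewrite mem_enum.
Qed.

Lemma range_comp_exists k l (v : 'I_k -> T) (w : 'I_l -> T) :
  range v `<=` range w -> exists f, v = w \o f.
Proof.
move=> vw; have h i : exists j, w j = v i.
  by have [|j _ <-] := vw (v i); [exists i|exists j].
by exists (fun i => sval (cid (h i))); apply/funext => i /=; case: cid.
Qed.

End TupleRanges.

Section Ranges.
Variables (L : language) (S : structure L).

Lemma vcat_lshift m n (w : 'I_m -> S) (v : 'I_n -> S) i : vcat w v (lshift n i) = w i.
Proof.
by rewrite /vcat; case: splitP => j /= ij; [congr w; apply/val_inj|
  move: (ltn_ord i); rewrite ij ltnNge leq_addr].
Qed.

Lemma vcat_rshift m n (w : 'I_m -> S) (v : 'I_n -> S) i : vcat w v (rshift m i) = v i.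
Proof.
rewrite /vcat; case: splitP => j /= ij.
  by move: (ltn_ord j); rewrite -ij ltnNge leq_addr.
by congr v; apply/val_inj; apply/eqP; rewrite -(eqn_add2l m) ij.
Qed.

Lemma range_vcons n x (v : 'I_n -> S) : range (vcons x v) = x |` range v.
Proof.
apply/seteqP; split=> y /=.
  by move=> [i _ <-]; rewrite /vcons; case: unliftP => [j|] _; [right; exists j|left].
by move=> [->|[j _ <-]]; [exists ord0|exists (lift ord0 j)]; rewrite ?vcons0 ?vconsS.
Qed.

Lemma range_vcat m n (w : 'I_m -> S) (v : 'I_n -> S) :
  range (vcat w v) = range w `|` range v.
Proof.
apply/seteqP; split=> y /=.
  by move=> [i _ <-]; rewrite /vcat; case: fintype.split => j; [left|right]; exists j.
by move=> [[j _ <-]|[j _ <-]]; [exists (lshift n j)|exists (rshift m j)];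
  rewrite ?vcat_lshift ?vcat_rshift.
Qed.

End Ranges.

Definition swap01 n (i : 'I_n.+2) : 'I_n.+2 :=
  if unlift ord0 i is Some j then
    if unlift ord0 j is Some k then lift ord0 (lift ord0 k) else ord0
  else lift ord0 ord0.

Lemma vcons_swap01 (L : language) (S : structure L) n (x y : S) (v : 'I_n -> S) :
  vcons x (vcons y v) \o @swap01 n = vcons y (vcons x v).
Proof.
apply/funext => i; rewrite /= /swap01 [RHS]/vcons.
case: (unliftP ord0 i) => [j|] _; last by rewrite vconsS vcons0.
rewrite [RHS]/vcons; case: (unliftP ord0 j) => [k|] _; last by rewrite vcons0.
by rewrite !vconsS.
Qed.

Lemma vcons_lift0 (L : language) (S : structure L) n (x y : S) (v : 'I_n -> S) :
  vcons x (vcons y v) \o up (lift ord0) = vcons x v.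
Proof. by rewrite vcons_up vcons_tail. Qed.

(** For [p(x, y, z)], the formula in [(y, x, z)] saying that [p(x, y, z)] holds
    and that [p(-, y, z)] has at most [N] solutions. *)
Definition fiber (L : language) N n (p : formula L n.+2) : formula L n.+2 :=
  And (ren p (@swap01 n)) (ren (AtMost N p) (up (lift ord0))).

Lemma sat_fiber (L : language) (S : structure L) N n (p : formula L n.+2)
    (x y : S) (v : 'I_n -> S) :
  sat (fiber N p) (vcons y (vcons x v)) =
  (sat p (vcons x (vcons y v)) /\ sat (AtMost N p) (vcons y v)).
Proof. by rewrite satAnd !sat_ren vcons_swap01 vcons_lift0. Qed.

Section Acl.
Variables (L : language) (S : structure L).
Implicit Types (A B : set S) (x y : S).

Definition algebraic k (v : 'I_k -> S) x :=
  exists (p : formula L k.+1) N, sat p (vcons x v) /\ sat (AtMost N p) v.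

Lemma algebraic_comp k l (v : 'I_k -> S) (w : 'I_l -> S) x :
  range v `<=` range w -> algebraic v x -> algebraic w x.
Proof.
move=> /range_comp_exists[f ->] [p [N [px pN]]]; exists (ren p (up f)), N.
rewrite sat_ren vcons_up; split=> //; move: pN; rewrite !satAtMost.
by congr atmost; apply/funext => y; rewrite /mkset sat_ren vcons_up.
Qed.

Lemma aclP A x :
  acl A x <-> exists k (v : 'I_k -> S), range v `<=` A /\ algebraic v x.
Proof.
have psolE (psi : pformula S 1) y : psol psi (tup1 y) =
    sat (pf_form psi : formula L (pf_size psi).+1) (vcons y (pf_par psi)).
  by rewrite /psol /defset /mkset vcat1.
split=> [[psi [Apsi fin px]]|[k [v [vA [p [N [px pN]]]]]]].
  exists (pf_size psi), (pf_par psi); split=> //.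
  have /finite_atmost[N fN] : finite_set [set y | psol psi (tup1 y)].
    apply: sub_finite_set (finite_image (fun w : 'I_1 -> S => w ord0) fin).
    by move=> y py; exists (tup1 y).
  exists (pf_form psi), N; rewrite -psolE satAtMost; split=> //.
  by apply: atmostW fN => y; rewrite /mkset -psolE.
exists (@PFormula L S 1 k p v); split=> //; last by rewrite psolE.
move: pN; rewrite satAtMost => pN.
have fin : finite_set [set y | sat p (vcons y v)] by apply/finite_atmost; exists N.
apply: sub_finite_set (finite_image (@tup1 L S) fin) => w pw; exists (w ord0).
  by move: pw; rewrite /psol /defset /mkset vcat1.
by apply/funext => i; rewrite /tup1 (ord1 i).
Qed.

Lemma acl_rangeP k (v : 'I_k -> S) x : acl (range v) x <-> algebraic v x.
Proof.
split=> [/aclP[l [w [wv]]]|vx]; first exact: algebraic_comp.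
by apply/aclP; exists k, v; split=> [?|].
Qed.

(** The formula [exists y, q(y, v) /\ p(x, y, v)] has at most [N1 * N2] solutions
    once [p] is restricted to the [y] for which it has at most [N2]. *)
Lemma algebraic_trans k (v : 'I_k -> S) x y :
  algebraic v y -> algebraic (vcons y v) x -> algebraic v x.
Proof.
move=> [q [N1 [qy]]]; rewrite satAtMost => qN [p [N2 [px pN]]].
pose q' : formula L k.+2 := ren q (up (lift ord0)).
exists (Ex (And q' (fiber N2 p))), (N1 * N2)%N.
have E z : sat (Ex (And q' (fiber N2 p))) (vcons z v) =
    exists2 y, sat q (vcons y v) &
      sat p (vcons z (vcons y v)) /\ sat (AtMost N2 p) (vcons y v).
  rewrite satEx; apply/propext; split=> [[y']|[y' qy' py']].
    by rewrite satAnd sat_fiber sat_ren vcons_lift0 => -[]; exists y'.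
  by exists y'; rewrite satAnd sat_fiber sat_ren vcons_lift0.
split; first by rewrite E; exists y.
rewrite satAtMost; pose Q y' z :=
  sat p (vcons z (vcons y' v)) /\ sat (AtMost N2 p) (vcons y' v).
apply: atmostW (atmost_bigcup (Q := Q) qN _) => [z|y' _]; first by rewrite /mkset E.
have [|nN2] := pselect (sat (AtMost N2 p) (vcons y' v)).
  by rewrite satAtMost; apply: atmostW => z [].
by exists [::] => // z [].
Qed.

Lemma acl_sub A : A `<=` acl A.
Proof.
move=> x Ax; apply/aclP; exists 1%N, (tup1 x); split; first by move=> _ [i _ <-].
exists (Equal (Var L ord0) (Var L (lift ord0 ord0))), 1%N.
have E y : sat (Equal (Var L ord0) (Var L (lift ord0 ord0)))
    (vcons y (tup1 x)) = (y = x) by rewrite /sat /= vcons0 vconsS.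
rewrite E satAtMost; split=> //; exists [:: x] => // y; rewrite /mkset E => ->.
by rewrite mem_head.
Qed.

(** The elements of [A] are eliminated one at a time by [algebraic_trans]; the
    tuple [w] collects the elements of [B] that replace them. *)
Lemma acl_trans A B : A `<=` acl B -> acl A `<=` acl B.
Proof.
move=> AB x /aclP[k [v [vA vx]]].
suff: forall k (v : 'I_k -> S) l (w : 'I_l -> S), range v `<=` acl B ->
    range w `<=` B -> algebraic (vcat v w) x -> acl B x.
  move=> /(_ _ v 0%N (fun i => v (widen_ord (leq0n k) i))); apply.
  - by move=> y /vA /AB.
  - by move=> y [[]].
  - by apply: algebraic_comp vx; rewrite range_vcat => y; left.
elim=> {k v vA vx} [|k IHk] v l w vB wB.
  by rewrite vcat0 => wx; apply/aclP; exists l, w.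
have /aclP[n [u [uB uv]]] : acl B (v ord0) by apply: vB; exists ord0.
rewrite -[v]vcons_eta vcat_vcons => vx; apply: (IHk (v \o lift ord0) _ (vcat w u)).
- by move=> _ [i _ <-]; apply: vB; exists (lift ord0 i).
- by rewrite range_vcat => y [/wB|/uB].
- apply: (@algebraic_trans _ _ _ (v ord0)).
    by apply: algebraic_comp uv; rewrite !range_vcat => y; right; right.
  apply: algebraic_comp vx; rewrite !range_vcons !range_vcat.
  by move=> y [->|[?|?]]; [left|right; left|right; right; left].
Qed.

Lemma acl_fin A x : acl A x -> exists2 s : seq S, [set` s] `<=` A & acl [set` s] x.
Proof.
move=> /aclP[k [v [vA vx]]]; exists (tuple_seq v); rewrite set_tuple_seq //.
exact/acl_rangeP.
Qed.

Lemma aclU_tuple k (v : 'I_k -> S) B x : acl (range v `|` B) x ->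
  exists2 s : seq S, [set` s] `<=` B & algebraic (vcat (seq_tuple s) v) x.
Proof.
move=> /acl_fin[s svB sx]; exists [seq y <- s | `[< B y >]].
  by move=> y; rewrite /= mem_filter => /andP[/asboolP].
apply/acl_rangeP; rewrite range_vcat range_seq_tuple.
apply: (acl_trans _ sx) => y ys; apply: acl_sub; have [yv|By] := svB y ys.
  by right.
by left; rewrite /= mem_filter ys andbT; apply/asboolP.
Qed.

(** The bounded form of exchange: if infinitely many [y] are such that [x] is
    one of at most [N] solutions of [p(-, y, z)], then [x] is one of boundedly
    many. *)
Definition exchange_scheme := forall n (p : formula L n.+2) N, exists K1 K2,
  forall z : 'I_n -> S, sat (AtMost K2 (Neg (AtMost K1 (fiber N p)))) z.

Lemma acl_exchange A x y : exchange_scheme ->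
  acl (y |` A) x -> ~ acl A x -> acl (x |` A) y.
Proof.
move=> exch yAx nAx; apply: contrapT => nxAy; apply: nAx.
have [s sA] : exists2 s : seq S, [set` s] `<=` A & algebraic (vcons y (seq_tuple s)) x.
  move: yAx; rewrite -[y |` A](_ : range (tup1 y) `|` A = _); last first.
    by congr setU; apply/seteqP; split=> [_ [i _ <-]//|_ ->]; exists ord0.
  move=> /aclU_tuple[s sA h]; exists s => //; apply: algebraic_comp h.
  rewrite range_vcons range_vcat => z [?|[i _ <-]]; [by right|by left].
set v := seq_tuple s => -[p [N [px pN]]]; have [K1 [K2 /(_ v)K]] := exch _ p N.
have vA : range v `<=` A by rewrite range_seq_tuple.
apply/aclP; exists (size s), v; split=> //.
exists (Neg (AtMost K1 (fiber N p))), K2; split=> //; rewrite satNeg => yK1.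
apply: nxAy; apply/aclP; exists (size s).+1, (vcons x v); split.
  by rewrite range_vcons; exact: setUS.
by exists (fiber N p), K1; rewrite sat_fiber.
Qed.

Lemma acl_pregeometry : exchange_scheme -> pregeometry (@acl L S).
Proof.
move=> exch; split; [exact: acl_sub|exact: acl_trans|exact: acl_fin|].
by move=> *; exact: acl_exchange.
Qed.

End Acl.

(** * Definable sets in a one-dimensional asymptotic class *)

Lemma ncard_uniq (T : choiceType) (A : set T) (s : seq T) :
  uniq s -> [set` s] = A -> ncard A = size s.
Proof.
move=> us sA; have fA : finite_set A by rewrite -sA; exact: finite_seq.
rewrite /ncard; apply: perm_size; apply: uniq_perm => // x.
apply/idP/idP; rewrite in_fset_set // -sA; first by move/set_mem.
by move=> xs; apply/mem_set.
Qed.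

Lemma finite_uniq_seq (T : choiceType) (A : set T) : finite_set A ->
  exists2 s : seq T, uniq s & [set` s] = A.
Proof.
move=> /finite_seqP[s ->]; exists (undup s); first exact: undup_uniq.
by apply/seteqP; split=> x /=; rewrite mem_undup.
Qed.

Lemma atmost_size (T : choiceType) (s : seq T) N :
  uniq s -> atmost N [set` s] <-> (size s <= N)%N.
Proof.
move=> us; split=> [[t tN st]|sN]; last by exists s.
by apply: leq_trans tN; apply: uniq_leq_size.
Qed.

Section AsymptoticClass.
Variables (R : realType) (L : language) (C : structure L -> Prop).
Hypothesis C_asymptotic : asymptotic_class_1dim R C.
Import Order.TTheory GRing.Theory Num.Theory.

Lemma finite_pos_lower_bound (E : set R) : finite_set E ->
  (forall mu, E mu -> 0 < mu) -> exists2 eps : R, 0 < eps & forall mu, E mu -> eps <= mu.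
Proof.
move=> /finite_seqP[s ->]; elim: s => [|x s IHs] pos; first by exists 1.
have [mu mus|eps eps0 h] := IHs; first by apply: pos; rewrite /= inE mus orbT.
exists (Num.min x eps); first by rewrite lt_min eps0 pos //= mem_head.
move=> mu; rewrite /= inE => /orP[/eqP->|/h]; first by rewrite ge_min lexx.
by rewrite ge_min orbC => ->.
Qed.

(** A definable set is either bounded or a positive proportion of the structure,
    uniformly in the parameters: the error term is negligible except in
    structures of bounded size, where every set is bounded. *)
Lemma class_gap n (p : formula L n.+1) : exists (K : nat) (eps : R), 0 < eps /\
  forall S, C S -> forall (z : 'I_n -> S) (s : seq S),
  uniq s -> [set` s] = [set x | sat p (vcons x z)] ->
  (size s <= K)%N \/ eps * (ncard [set: S])%:R <= (size s)%:R.
Proof.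
have [finC /(_ n p)[K [E [[K0 finE E0] [dich _]]]]] := C_asymptotic.
have [eps eps0 epsE] := finite_pos_lower_bound finE E0.
(* If [size s] is below half of the main term, then [K * sqrt |S|] exceeds
   [eps / 2 * |S|], so that [|S|] is smaller than [4 * K ^+ 2 / eps ^+ 2]. *)
pose K' := Num.bound (K + 4 * K ^+ 2 / eps ^+ 2).
have K'E : K + 4 * K ^+ 2 / eps ^+ 2 < K'%:R.
  by apply: archi_boundP; rewrite addr_ge0 ?divr_ge0 ?mulr_ge0 ?sqr_ge0 ?ltW.
exists K', (eps / 2); split=> [|S CS z s us sE]; first by rewrite divr_gt0.
have cards : ncard (defset (m := 1) p z) = size s.
  rewrite (@ncard_uniq _ _ [seq tup1 x | x <- s]) ?size_map //.
    by rewrite map_inj_uniq // => x y /(congr1 (@^~ ord0)).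
  apply/seteqP; split=> w /=.
    move=> /mapP[x xs ->]; rewrite /defset /mkset vcat1.
    by have : [set` s] x by []; rewrite sE.
  rewrite /defset /mkset vcat1 => pw; have ws : [set` s] (w ord0) by rewrite sE.
  by apply/mapP; exists (w ord0) => //; apply/funext => i; rewrite /tup1 (ord1 i).
have [t ut tE] := finite_uniq_seq (finC S CS).
have le_st : (size s <= size t)%N.
  by apply: uniq_leq_size => // x _; have : [set` t] x by rewrite tE.
have := dich S CS z; rewrite /near_mu cards (ncard_uniq ut tE).
set N : R := (size t)%:R; set c : R := (size s)%:R.
have cN : c <= N by rewrite ler_nat.
have N0 : 0 <= N by rewrite ler0n.
have big : 0 <= 4 * K ^+ 2 / eps ^+ 2.
  by rewrite divr_ge0 ?mulr_ge0 ?sqr_ge0 ?ltW.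
case=> [cK|[mu muE]].
  by left; rewrite -(ler_nat R) (le_trans cK) // ltW // (le_lt_trans _ K'E) // lerDl.
set q := Num.sqrt N; have qN : q ^+ 2 = N by rewrite sqr_sqrtr.
rewrite ler_norml => /andP[lo _].
have q0 : 0 <= q by rewrite sqrtr_ge0.
have [Kq|Kq] := leP (K * q) (eps / 2 * N).
  right; have : eps * N <= mu * N by rewrite ler_wpM2r // epsE.
  by move: lo Kq; lra.
left; rewrite -(ler_nat R) ltW // (le_lt_trans cN) // (le_lt_trans _ K'E) //.
have qK : q <= 2 * K / eps.
  have [->|qn0] := eqVneq q 0; first by rewrite divr_ge0 ?mulr_ge0 ?ltW.
  have qp : 0 < q by rewrite lt_neqAle eq_sym qn0.
  move: Kq; rewrite -qN expr2 mulrA ltr_pM2r // => /ltW h.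
  by rewrite ler_pdivlMr //; move: h; lra.
rewrite -qN (le_trans (_ : _ <= (2 * K / eps) ^+ 2)) //.
  by rewrite ler_sqr ?nnegrE // (le_trans q0).
have -> : (2 * K / eps) ^+ 2 = 4 * K ^+ 2 / eps ^+ 2.
  by field; rewrite gt_eqF.
by rewrite lerDr ltW.
Qed.

(** By [class_gap] a set with more than [K] elements has more than [K'] of them as
    soon as the structure is large enough. *)
Lemma class_large n (p : formula L n.+1) : exists K : nat, forall K' : nat,
  exists B : nat, forall S, C S -> (B <= ncard [set: S])%N ->
  forall z : 'I_n -> S, sat (AtMost K' p) z -> sat (AtMost K p) z.
Proof.
have [K [eps [eps0 gap]]] := class_gap p; exists K => K'.
exists (Num.bound (K'.+1%:R / eps)) => S CS BS z.
rewrite !satAtMost => pK'.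
have [|s us sE] := finite_uniq_seq (A := [set x | sat p (vcons x z)]).
  by apply/finite_atmost; exists K'.
move: pK'; rewrite -sE !atmost_size // => sK'.
have [//|big] := gap S CS z s us sE.
suff : K'.+1%:R <= (size s)%:R :> R by rewrite ler_nat ltnNge sK'.
apply: le_trans big; rewrite mulrC -ler_pdivrMr // ltW //.
apply: lt_le_trans (archi_boundP _) _; first by rewrite divr_ge0 // ltW.
by rewrite ler_nat.
Qed.

(** Double counting: if [D] is the set of the [x] with many [y] in their fiber,
    then the fibers have at least [eps * |S|] elements and each [y] is in at most
    [N] of them, whence [|D| * eps * |S| <= N * |S|]. *)
Lemma class_exchange n (p : formula L n.+2) N : exists K1 K2 : nat,
  forall S, C S -> forall z : 'I_n -> S,
  sat (AtMost K2 (Neg (AtMost K1 (fiber N p)))) z.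
Proof.
have [K1 [eps [eps0 gap]]] := class_gap (fiber N p).
exists K1, (Num.bound (N%:R / eps)) => S CS z.
have finS := C_asymptotic.1 S CS.
have finA (A : set S) : finite_set A by exact: sub_finite_set finS.
have [t ut tE] := finite_uniq_seq finS; have tT x : x \in t.
  by have : [set` t] x by rewrite tE.
rewrite satAtMost.
have [D uD DE] := finite_uniq_seq
  (finA [set x | sat (Neg (AtMost K1 (fiber N p))) (vcons x z)]).
rewrite -DE atmost_size //.
pose b x y := `[< sat (fiber N p) (vcons y (vcons x z)) >].
have row x : x \in D -> eps * (size t)%:R <= (count (b x) t)%:R.
  move=> xD; have : [set` D] x by []; rewrite DE /mkset satNeg satAtMost.
  have [s us sE] := finite_uniq_seq (finA [set y | sat (fiber N p) (vcons y (vcons x z))]).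
  rewrite -sE atmost_size // => nsK1.
  have [//|] := gap S CS _ s us sE; rewrite (ncard_uniq ut tE) => /le_trans; apply.
  rewrite ler_nat -size_filter; apply: uniq_leq_size => // y ys.
  rewrite mem_filter tT andbT; apply/asboolP.
  by have : [set` s] y by []; rewrite sE.
have col y : (count (b ^~ y) D <= N)%N.
  have [pN|npN] := pselect (sat (AtMost N p) (vcons y z)).
    move: pN; rewrite satAtMost => -[s sN sp]; apply: leq_trans sN.
    rewrite -size_filter; apply: uniq_leq_size; first exact: filter_uniq.
    move=> x; rewrite mem_filter => /andP[/asboolP]; rewrite sat_fiber => -[px _] _.
    exact: sp.
  rewrite (@eq_count _ _ pred0) ?count_pred0 // => x; apply/asboolP.
  by rewrite sat_fiber => -[].
have dbl : (\sum_(x <- D) count (b x) t <= N * size t)%N.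
  have -> : (\sum_(x <- D) count (b x) t = \sum_(y <- t) count (b ^~ y) D)%N.
    under eq_bigr do rewrite -sum1_count big_mkcond.
    by rewrite exchange_big; apply: eq_bigr => y _; rewrite -sum1_count [RHS]big_mkcond.
  apply: leq_trans (_ : \sum_(y <- t) N <= _)%N; first exact: leq_sum.
  by rewrite big_const_seq count_predT iter_addn_0.
have t0 : 0 < (size t)%:R :> R.
  by have [x0] := dom_nonempty S; rewrite ltr0n; case: (t) (tT x0).
rewrite -(ler_nat R) ltW // (le_lt_trans _ (archi_boundP _)) //; last first.
  by rewrite divr_ge0 // ltW.
rewrite ler_pdivlMr // -(ler_pM2r t0) -natrM.
apply: le_trans (_ : (\sum_(x <- D) count (b x) t)%:R <= _); last by rewrite ler_nat.
rewrite natr_sum -mulrA mulr_natl -[size D]count_predT -iter_addr_0.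
rewrite -big_const_seq big_seq [leRHS]big_seq; apply: ler_sum => x; exact: row.
Qed.

End AsymptoticClass.

(** * Passing to models of the theory *)

Section Transfer.
Variable L : language.

Definition closure n (p : formula L n) : formula L 0 :=
  Neg (ExN (ren (Neg p) (lshift 0))).

Lemma sat_closure (S : structure L) n (p : formula L n) (v : 'I_0 -> S) :
  sat (closure p) v <-> forall w : 'I_n -> S, sat p w.
Proof.
have E w : vcat w v \o lshift 0 = w.
  by apply/funext => i; rewrite /= vcat_lshift.
rewrite /closure satNeg satExN; split=> [h w|h [w]].
  by apply: contrapT => nw; apply: h; exists w; rewrite sat_ren E.
by rewrite sat_ren E; apply; exact: h.
Qed.

Lemma models_transfer (M S : structure L) n (p : formula L n) :
  models S (theory M) ->
  (forall w : 'I_n -> M, sat p w) -> forall w : 'I_n -> S, sat p w.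
Proof.
move=> SM Mp; have [x0] := dom_nonempty S; have v0 : 'I_0 -> S by move=> _; exact: x0.
by apply/(sat_closure p v0); apply: SM => v; apply/sat_closure.
Qed.

(** Elimination of the quantifier that says that there are infinitely many. *)
Definition bounds_scheme (S : structure L) := forall n (p : formula L n.+1),
  exists K, forall K' (z : 'I_n -> S), sat (AtMost K' p) z -> sat (AtMost K p) z.

Definition geometric_structure S := exchange_scheme S /\ bounds_scheme S.

Lemma geometric_models (M S : structure L) :
  models S (theory M) -> geometric_structure M -> geometric_structure S.
Proof.
move=> SM [exch bnd]; split=> n p => [N|].
  have [K1 [K2 h]] := exch n p N; exists K1, K2; exact: models_transfer h.
have [K h] := bnd n p; exists K => K'.
by apply: (@models_transfer M S n (Imp (AtMost K' p) (AtMost K p))) => // z; exact: h.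
Qed.

End Transfer.

Section TransferUltraproduct.
Variables (R : realType) (L : language) (C : structure L -> Prop).
Hypothesis C_asymptotic : asymptotic_class_1dim R C.
Variables (I : Type) (U : set_system I) (UU : UltraFilter U).
Variable S_ : I -> structure L.
Local Notation S := (ultraproduct UU S_).

Lemma ultraproduct_near n (p : formula L n) :
  (\forall i \near U, forall z : 'I_n -> S_ i, sat p z) -> forall z : 'I_n -> S, sat p z.
Proof.
move=> near_p z; have -> : z = fun j => uclass UU (urepr (z j)).
  by apply/funext => j; rewrite ureprK.
by apply/sat_ultraproduct; apply: filterS near_p.
Qed.

Lemma ultraproduct_large (p : formula L 1) : (forall i, finite_set [set: S_ i]) ->
  infinite_set [set x : S | sat p (fun=> x)] ->
  forall B, \forall i \near U, (B <= ncard [set x : S_ i | sat p (fun=> x)])%N.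
Proof.
move=> finS infp B; pose v (j : 'I_0) i : S_ i := False_rect _ (notF (ltn_ord j)).
have E (S' : structure L) (w : 'I_0 -> S') :
    [set x | sat p (vcons x w)] = [set x | sat p (fun=> x)].
  apply/funext => x; rewrite /mkset; congr (sat p _); apply/funext => i.
  by rewrite (ord1 i) vcons0.
have /(sat_ultraproduct UU (Neg (AtMost B p)) v) : sat (Neg (AtMost B p))
    (fun j => uclass UU (v j) : S).
  by rewrite satNeg satAtMost E => fin; apply: infp; apply/finite_atmost; exists B.
apply: filterS => i; rewrite satNeg satAtMost E => nB.
have [|s us sE] := finite_uniq_seq (A := [set x : S_ i | sat p (fun=> x)]).
  exact: sub_finite_set (finS i).
rewrite (ncard_uniq us sE) leqNgt; apply/negP => sB; apply: nB.
by rewrite -sE; apply/atmost_size => //; exact: ltnW.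
Qed.

Lemma geometric_ultraproduct : (forall i, C (S_ i)) ->
  infinite_set [set: S] -> geometric_structure S.
Proof.
move=> CS infS; pose top : formula L 1 := Neg (Falsum L 1).
have topE (S' : structure L) : [set x : S' | sat top (fun=> x)] = [set: S'].
  by apply/seteqP; split=> // x _; rewrite /mkset satNeg.
have large := @ultraproduct_large top (fun i => C_asymptotic.1 _ (CS i)).
rewrite topE in large; have {}large := large infS.
split=> n p => [N|].
  have [K1 [K2 h]] := class_exchange C_asymptotic p N; exists K1, K2.
  by apply: ultraproduct_near; apply: nearW => i; exact: h.
have [K h] := class_large C_asymptotic p; exists K => K'; have [B hB] := h K'.
apply: (@ultraproduct_near _ (Imp (AtMost K' p) (AtMost K p))).
by apply: filterS (large B) => i; rewrite topE => Bi; exact: hB.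
Qed.

End TransferUltraproduct.

(** * Saturation *)

Lemma ultrafilter_of_base (J T : Type) (D : set J) (B : J -> set T) :
  (exists i, D i) ->
  (forall i j, D i -> D j -> exists2 k, D k & B k `<=` B i `&` B j) ->
  (forall i, D i -> B i !=set0) ->
  exists2 G : set_system T, UltraFilter G & forall i, D i -> G (B i).
Proof.
move=> D0 cap B0; have [G [GU DG]] :=
  ultraFilterLemma (filter_from_proper (filter_from_filter D0 cap) B0).
by exists G => // i Di; apply: DG; exists i.
Qed.

Lemma filter_finite_forall (J T : Type) (G : set_system T) (s : set J)
    (P : J -> set T) : Filter G -> finite_set s -> (forall j, s j -> G (P j)) ->
  G [set x | forall j, s j -> P j x].
Proof.
move=> FG /(@finite_seqP {classic J})[l ->].
elim: l => [|j l IHl] GP; first by apply: filterS filterT => x _ j.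
have {}IHl : G [set x | forall j, [set` l] j -> P j x].
  by apply: IHl => k kl; apply: GP; rewrite /= inE kl orbT.
have Gj : G (P j) by apply: GP; exact: mem_head.
by apply: filterS2 Gj IHl => x Pjx lx k; rewrite /= inE => /orP[/eqP->|/lx].
Qed.

Lemma Forall_cat T (P : T -> Prop) (l l' : seq T) :
  List.Forall P (l ++ l') <-> List.Forall P l /\ List.Forall P l'.
Proof. exact: List.Forall_app. Qed.

Fixpoint imp_depth (L : language) n (p : formula L n) : nat :=
  if p is Imp _ _ q then (imp_depth q).+1 else 0.

(** There are tautologies of every depth. *)
Lemma infinite_theory (L : language) (T : set (formula L 0)) :
  (forall p, (forall (S : structure L) (v : 'I_0 -> S), sat p v) -> T p) ->
  infinite_set T.
Proof.
move=> taut; pose f k : formula L 0 := iter k (Imp (Falsum L 0)) (Neg (Falsum L 0)).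
have fd k : imp_depth (f k) = k.+1 by elim: k => //= k ->.
move=> /(finite_image (fun p => (imp_depth p).-1)) finT.
apply: infinite_nat; apply: sub_finite_set finT => k _.
exists (f k); last by rewrite fd.
by apply: taut => S v; case: k => [|k]; rewrite /sat /= => -[].
Qed.

Lemma finite_card_le T T' (A : set T) (B : set T') :
  infinite_set B -> finite_set A -> A #<= B.
Proof.
move=> /infiniteP infB /finite_set_leP[n An].
by apply: card_le_trans An (card_le_trans _ infB); apply: subset_card_le.
Qed.

Section Realize.
Variables (L : language) (S : structure L).

(** Finite satisfiability is the finite intersection property of [G], and
    completeness is its maximality. *)
Lemma ultrafilter_type (A : set S) (G : set_system S) : UltraFilter G ->
  let p := [set psi : pformula S 1 | has_par A psi /\ G [set x | psol psi (tup1 x)]] in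
  complete_type A p.
Proof.
move=> GU p; split=> [psi []//|s fs sp|psi Apsi].
  have : G [set x | forall psi, s psi -> psol psi (tup1 x)].
    by apply: filter_finite_forall fs _ => psi /sp[].
  by move=> /filter_ex[x sx]; exists (tup1 x) => psi /sx.
have [|] := in_ultra_setVsetC [set x | psol psi (tup1 x)] GU; first by left.
by right.
Qed.

Variable T : set (formula L 0).
Hypotheses (infT : infinite_set T) (S_sat : saturated S T).

Lemma saturated_realize n (v : 'I_n -> S) (Gamma : set (formula L n.+1)) :
  (forall l, List.Forall Gamma l -> exists x, sat (Conj l) (vcons x v)) ->
  exists x, forall p, Gamma p -> sat p (vcons x v).
Proof.
move=> fin_sat.
have [||G GU GG] := @ultrafilter_of_base _ S [set l | List.Forall Gamma l]
  (fun l => [set x | sat (Conj l) (vcons x v)]) (ex_intro _ [::] (List.Forall_nil _)).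
- move=> l l' Gl Gl'; exists (l ++ l'); first by apply/Forall_cat; split.
  move=> x; rewrite /mkset satConj => /Forall_cat[? ?].
  by split; rewrite /mkset satConj.
- by move=> l /fin_sat[x lx]; exists x.
have rT : range v #<= T.
  by apply: finite_card_le => //; rewrite -set_tuple_seq; exact: finite_seq.
have [x px] := S_sat rT (ultrafilter_type (range v) GU).
exists x => p Gp; have := px (@PFormula L S 1 n p v).
rewrite /psol /defset /mkset vcat1; apply; split=> //=.
apply: filterS (GG [:: p] _); last by constructor.
by move=> y; rewrite /mkset vcat1 satConj => h; inversion h.
Qed.

(** The variables are realized one at a time: the other ones first realize the
    formulas that assert the existence of a value for the first variable. *)
Lemma saturated_realizeN m n (v : 'I_n -> S) (Gamma : set (formula L (m + n))) :
  (forall l, List.Forall Gamma l -> exists w, sat (Conj l) (vcat w v)) ->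
  exists w, forall p, Gamma p -> sat p (vcat w v).
Proof.
elim: m Gamma => [|m IHm] Gamma fin_sat.
  have [w _] := fin_sat [::] (List.Forall_nil _); exists w => p Gp.
  have [|w'] := fin_sat [:: p]; first by constructor.
  by rewrite !vcat0 satConj => h; inversion h.
pose Gamma' : set (formula L (m + n)) :=
  [set Ex (Conj l : formula L (m + n).+1) | l in [set l | List.Forall Gamma l]].
have [l Gl|w hw] := IHm Gamma'.
  have [l0 Gl0 l0l] : exists2 l0, List.Forall Gamma l0 & forall x : 'I_(m + n) -> S,
      sat (Ex (Conj l0 : formula L (m + n).+1)) x -> sat (Conj l) x.
    elim: l Gl => [|p l IHl] Gl; first by exists [::] => // x _; rewrite satConj.
    have [[l1 Gl1 pE] /IHl[l2 Gl2 ll2]] : Gamma' p /\ List.Forall Gamma' l.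
      by inversion Gl.
    exists (l1 ++ l2); first by apply/Forall_cat; split.
    move=> x; rewrite satEx => -[y].
    rewrite [sat (Conj (_ ++ _)) _]satConj => /Forall_cat[y1 y2].
    rewrite satConj; constructor.
      by rewrite -pE satEx; exists y; rewrite satConj.
    by rewrite -satConj; apply: ll2; rewrite satEx; exists y; rewrite satConj.
  have [w] := fin_sat _ Gl0; rewrite -(vcons_eta w) vcat_vcons => lw.
  by exists (w \o lift ord0); apply: l0l; rewrite satEx; exists (w ord0).
have [l Gl|x hx] := @saturated_realize _ (vcat w v) Gamma.
  have := hw (Ex (Conj l)); rewrite satEx; apply; by exists l.
by exists (vcons x w) => p /hx; rewrite vcat_vcons.
Qed.

End Realize.

(** * First-order properties of H-structures *)

Lemma satConj_map (L : language) (S : structure L) n (J : eqType) (s : seq J)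
    (F : J -> formula L n) (v : 'I_n -> S) :
  sat (Conj [seq F j | j <- s]) v <-> forall j, j \in s -> sat (F j) v.
Proof.
rewrite satConj; elim: s => [|j s IHs] /=; first by split=> // _; constructor.
split=> [h|h].
  have [Fj /IHs Fs] : sat (F j) v /\ List.Forall (fun p => sat p v) [seq F j | j <- s].
    by inversion h.
  by move=> k; rewrite inE => /orP[/eqP->|/Fs].
constructor; first by apply: h; exact: mem_head.
by apply/IHs => k ks; apply: h; rewrite inE ks orbT.
Qed.

Section AlgebraicOverH.
Variables (L : language) (r m n : nat).

Definition mid_shift (i : 'I_(r + n)) : 'I_(r + (m + n)) :=
  match fintype.split i with
  | inl k => lshift (m + n) k
  | inr k => rshift r (rshift m k)
  end.

Definition mid_pick (j : 'I_m) (i : 'I_(r + n).+1) : 'I_(r + (m + n)) :=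
  if unlift ord0 i is Some k then mid_shift k else rshift r (lshift n j).

Definition onH : formula (lang_H L) (r + (m + n)) :=
  Conj [seq InH L (lshift (m + n) i) | i <- enum 'I_r].

Variables (J : pred 'I_m) (theta : 'I_m -> formula L (r + n).+1) (N : 'I_m -> nat).

Definition alg_core : formula (lang_H L) (r + (m + n)) :=
  Conj [seq And (ren (lift_form (theta j)) (mid_pick j))
                (ren (lift_form (AtMost (N j) (theta j))) mid_shift)
       | j <- enum J].

(** In the variables [(x, z)]: for some [r]-tuple [h] of elements of [H], each
    [x_j] with [J j] is one of at most [N j] solutions of [theta_j(-, h, z)]. *)
Definition AlgH : formula (lang_H L) (m + n) := ExN (And onH alg_core).

Variable S : structure (lang_H L).
Local Notation S0 := (reduct S).
Implicit Types (h : 'I_r -> S0) (x : 'I_m -> S0) (z : 'I_n -> S0).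

Lemma vcat_mid_shift h x z : vcat h (vcat x z) \o mid_shift = vcat h z.
Proof.
apply/funext => i; rewrite /= /mid_shift [RHS]/vcat.
by case: fintype.split => k; rewrite ?vcat_lshift ?vcat_rshift.
Qed.

Lemma vcat_mid_pick j h x z :
  vcat h (vcat x z) \o mid_pick j = vcons (x j) (vcat h z).
Proof.
apply/funext => i; rewrite /= /mid_pick [RHS]/vcons.
case: unlift => [k|]; last by rewrite vcat_rshift vcat_lshift.
by rewrite -(vcat_mid_shift h x z).
Qed.

Lemma sat_onH h x z :
  @sat (lang_H L) S _ onH (vcat h (vcat x z)) <-> forall i, Hset (h i).
Proof.
rewrite satConj_map; split=> [hH i|hH i _].
  by have := hH i (mem_enum _ _); rewrite sat_InH vcat_lshift.
by rewrite sat_InH vcat_lshift; exact: hH.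
Qed.

Lemma sat_alg_core h x z :
  @sat (lang_H L) S _ alg_core (vcat h (vcat x z)) <->
  forall j, J j -> sat (theta j) (vcons (x j) (vcat h z)) /\
                   sat (AtMost (N j) (theta j)) (vcat h z).
Proof.
have E j : @sat (lang_H L) S _ (And (ren (lift_form (theta j)) (mid_pick j))
      (ren (lift_form (AtMost (N j) (theta j))) mid_shift)) (vcat h (vcat x z)) =
    (sat (theta j) (vcons (x j) (vcat h z)) /\ sat (AtMost (N j) (theta j)) (vcat h z)).
  by rewrite satAnd !sat_ren !sat_lift vcat_mid_pick vcat_mid_shift.
rewrite satConj_map; split=> [c j Jj|c j]; last by rewrite mem_enum => /c; rewrite E.
by rewrite -E; apply: c; rewrite mem_enum.
Qed.

Lemma sat_AlgH x z : @sat (lang_H L) S _ AlgH (vcat x z) <->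
  exists h, (forall i, Hset (h i)) /\
    forall j, J j -> sat (theta j) (vcons (x j) (vcat h z)) /\
                     sat (AtMost (N j) (theta j)) (vcat h z).
Proof.
rewrite /AlgH satExN; split=> [[h]|[h [hH c]]].
  by rewrite satAnd => -[/sat_onH hH /sat_alg_core c]; exists h.
by exists h; rewrite satAnd; split; [exact/sat_onH|exact/sat_alg_core].
Qed.

End AlgebraicOverH.

(** Not being algebraic over [z] and [H] is the conjunction of these formulas in
    [(x, z)]; as an infinite conjunction it is accessible to saturation only. *)
Definition not_alg_over_H (L : language) n : set (formula (lang_H L) n.+1) :=
  [set q | exists r (theta : formula L (r + n).+1) N,
     q = Neg (@AlgH L r 1 n predT (fun=> theta) (fun=> N))].

Section NotAlg.
Variables (L : language) (S : structure (lang_H L)).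
Local Notation S0 := (reduct S).

Lemma sat_not_alg_over_H n (z : 'I_n -> S0) (x : S0) :
  (forall q, not_alg_over_H q -> @sat (lang_H L) S _ q (vcons x z)) <->
  ~ acl (range z `|` Hset (N := S)) x.
Proof.
have E r (theta : formula L (r + n).+1) N :
    @sat (lang_H L) S _ (Neg (@AlgH L r 1 n predT (fun=> theta) (fun=> N))) (vcons x z) <->
    ~ exists h : 'I_r -> S0, (forall i, Hset (h i)) /\
      sat theta (vcons x (vcat h z)) /\ sat (AtMost N theta) (vcat h z).
  rewrite satNeg -[vcons x z]/(vcons (tup1 x ord0) z) -vcat1 sat_AlgH.
  split; apply: contra_not => -[h [hH c]]; exists h; split=> //.
  by case: (c ord0).
split=> [h|nx q [r [theta [N ->]]]]; last first.
  apply/E => -[h [hH c]]; apply: nx; apply/aclP; exists _, (vcat h z); split.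
    by rewrite range_vcat => y [[i _ <-]|zy]; [right|left].
  by exists theta, N.
move=> /aclU_tuple[s sH [theta [N c]]].
have /E : @sat (lang_H L) S _
    (Neg (@AlgH L (size s) 1 n predT (fun=> theta) (fun=> N))) (vcons x z).
  by apply: h; exists (size s), theta, N.
apply; exists (seq_tuple s); split=> // i; apply: sH.
by rewrite -range_seq_tuple; exists i.
Qed.

(** The density and the extension property of H-structures as first-order schemes:
    by elimination of the infinity quantifier, having more than [K] solutions
    stands for being non-algebraic. *)
Definition Hdense := forall n (p : formula L n.+1), exists K, forall N (z : 'I_n -> S),
  sat (Imp (Neg (lift_form (AtMost K p)))
           (Neg (AtMost N (And (InH L ord0) (lift_form p))))) z.

Definition Hgeneric := forall n (p : formula L n.+1), exists K,
  forall l, List.Forall (@not_alg_over_H L n) l -> forall z : 'I_n -> S,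
  sat (Imp (Neg (lift_form (AtMost K p))) (Ex (And (lift_form p) (Conj l)))) z.

End NotAlg.

Section Dimension.
Variables (L : language) (S : structure L).
Implicit Types A B : set S.

Lemma indep_subtuple_inj B n (a : 'I_n -> S) (t : {set 'I_n}) :
  indep_subtuple B a t -> {in t &, injective a}.
Proof.
move=> ind i j it jt aij; apply/eqP; apply: contrapT => /negP ij.
by apply: (ind i it); apply: acl_sub; right; exists j => //=; rewrite eq_sym.
Qed.

Lemma finite_dim_finite A : finite_set A -> finite_dim A.
Proof.
move=> /finite_seqP[s ->]; exists (size s) => n a as_; apply/bigmax_leqP => t.
move=> /asboolP ind; rewrite cardE -(size_map a); apply: uniq_leq_size.
  rewrite map_inj_in_uniq ?enum_uniq // => i j; rewrite !mem_enum.
  exact: indep_subtuple_inj ind _ _.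
by move=> _ /mapP[i _ ->]; apply: as_; exists i.
Qed.

Lemma tdim_exists n (a : 'I_n -> S) B :
  exists2 t : {set 'I_n}, indep_subtuple B a t & #|t| = tdim a B.
Proof.
have ind0 : indep_subtuple B a finset.set0 by move=> i; rewrite inE.
have [t /asboolP ind_t max_t] := @arg_maxnP _ finset.set0
  (fun t : {set 'I_n} => `[< indep_subtuple B a t >]) (fun t => #|t|) (asboolT ind0).
exists t => //; apply/eqP; rewrite eqn_leq; apply/andP; split.
  by rewrite /tdim (@leq_bigmax_cond _ _ (fun t : {set 'I_n} => #|t|)) //; apply/asboolP.
exact/bigmax_leqP.
Qed.

Lemma leq_tdim n (a : 'I_n -> S) B (t : {set 'I_n}) :
  indep_subtuple B a t -> (#|t| <= tdim a B)%N.
Proof.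
move=> ind; rewrite /tdim.
by rewrite (@leq_bigmax_cond _ _ (fun t : {set 'I_n} => #|t|)) //; apply/asboolP.
Qed.

Hypothesis clP : pregeometry (@acl L S).

Lemma tdim_tup1 (a : S) B : ~ acl B a -> tdim (tup1 a) B = 1%N.
Proof.
move=> na; apply/eqP; rewrite eqn_leq; apply/andP; split.
  apply/bigmax_leqP => t _; apply: leq_trans (max_card _) _; by rewrite card_ord.
rewrite -[X in (X <= _)%N](cards1 (ord0 : 'I_1)); apply: leq_tdim => i.
rewrite inE => /eqP ->.
apply: contra_not na; apply: (cl_mono clP) => x [//|[j /= [_ +] _]].
by rewrite (ord1 j) eqxx.
Qed.

Lemma perp_tup1 (a : S) B F : ~ acl B a -> perp (tup1 a) B F -> ~ acl (B `|` F) a.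
Proof.
move=> na; rewrite /perp (tdim_tup1 na) => dim1 a_alg.
have [t ind] := tdim_exists (tup1 a) (B `|` F); rewrite dim1 => t1.
have [i it] : exists i, i \in t by apply/card_gt0P; rewrite t1.
by apply: (ind i it); apply: (cl_mono clP) a_alg => x; left.
Qed.

(** An element outside the closure of a maximal independent subtuple could be
    added to it, by exchange. *)
Lemma tdim_generates n (a : 'I_n -> S) B (t : {set 'I_n}) :
  indep_subtuple B a t -> #|t| = tdim a B ->
  forall i, acl (B `|` [set a j | j in [set j | j \in t]]) (a i).
Proof.
move=> ind card_t i.
have [it|nit] := boolP (i \in t); first by apply: acl_sub; right; exists i.
apply: contrapT => nai.
have : indep_subtuple B a (i |: t).
  move=> j; rewrite !inE; case: eqVneq => [->{j} _|ji /= jt].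
    apply: contra_not nai; apply: (cl_mono clP) => x [Bx|[k /= [+ ki] <-]]; first by left.
    by rewrite !inE (negbTE ki) /= => kt; right; exists k.
  set D := B `|` [set a k | k in [set k | k \in t /\ k != j]].
  have nDj : ~ acl D (a j).
    apply: contra_not (ind j jt); apply: (cl_mono clP) => x [?|[k /= [kt kj] <-]].
      by left.
    by right; exists k => //=; rewrite kt.
  move=> jalg; apply: nai.
  have : acl (a j |` D) (a i).
    apply: (cl_exchange clP) nDj; apply: (cl_mono clP) jalg.
    move=> x [?|[k /= [+ kj] <-]]; first by right; left.
    by rewrite !inE => /orP[/eqP->|kt]; [left|right; right; exists k].
  apply: (cl_mono clP) => x [->|[?|[k /= [kt _] <-]]]; [|by left|].
    by right; exists j.
  by right; exists k.
by move=> /leq_tdim; rewrite cardsU1 nit -card_t add1n ltnn.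
Qed.

(** By the equality of dimensions, a subtuple that is maximal independent over [H]
    generates the whole tuple over the part of the tuple in [H].  If an element of
    [H] depended on the tuple and the rest of [H], exchange would make a member of
    the subtuple depend on the others and [H]. *)
Lemma perp_Hfree n (a : 'I_n -> S) (H : set S) : alg_independent H ->
  perp a (range a `&` H) H -> Hfree (@acl L S) H (range a).
Proof.
set B := range a `&` H => indH dimE h Hh nah h_alg.
have [t ind card_t] := tdim_exists a (B `|` H).
have indB : indep_subtuple B a t.
  move=> i it; apply: contra_not (ind i it); apply: (cl_mono clP).
  by move=> x [?|?]; [left; left|right].
have gen := tdim_generates indB (etrans card_t dimE).
pose s := [seq a j | j <- enum t].
have sP j : j \in t -> a j \in s by move=> jt; apply: map_f; rewrite mem_enum.
have : acl (H `\ h `|` [set` s]) h.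
  apply: (cl_trans clP _ h_alg) => x [[i _ <-]|?]; last by apply: acl_sub; left.
  apply: (cl_mono clP) (gen i) => y [[ay Hy]|[j /= jt <-]].
    by left; split=> // yh; apply: nah; rewrite -yh.
  by right; exact: sP.
move=> /(cl_exchange_seq clP)[|y /mapP[j]]; first exact: indH.
rewrite mem_enum => jt -> aj; apply: (ind j jt); apply: (cl_mono clP) aj.
move=> x [[->|[Hx _]]|[/mapP[k]]]; [by left; right|by left; right|].
rewrite mem_enum => kt -> akj; right; exists k => //=; rewrite kt; split=> //.
by apply/eqP => kj; apply: akj; rewrite kj.
Qed.

(** The type is defined by an ultrafilter that contains the solutions of [p] and
    all cofinite sets: no finite definable set can belong to it. *)
Lemma nonalgebraic_type n (z : 'I_n -> S) (p : formula L n.+1) A :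
  range z `<=` A -> infinite_set [set x | sat p (vcons x z)] ->
  exists P : set (pformula S 1), [/\ complete_type A P, nonalgebraic P &
    forall x, realizes (tup1 x) P -> sat p (vcons x z) /\ ~ acl A x].
Proof.
move=> zA inf_p; pose B (s : seq S) := [set x | sat p (vcons x z) /\ x \notin s].
have [|||G GU GB] := @ultrafilter_of_base _ S setT B.
- by exists [::].
- move=> s t _ _; exists (s ++ t) => // x [px].
  by rewrite mem_cat negb_or => /andP[xs xt]; split; split.
- move=> s _; apply: contrapT => B0; apply: inf_p.
  apply: sub_finite_set (finite_seq s) => x px; apply: contrapT => /negP xs.
  by apply: B0; exists x.
have cP := ultrafilter_type A GU; set P := [set psi | _] in cP.
have nonalg : nonalgebraic P.
  move=> psi [_ Gpsi] fin.
  have /finite_seqP[s sE] : finite_set [set x | psol psi (tup1 x)].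
    apply: sub_finite_set (finite_image (fun w : 'I_1 -> S => w ord0) fin).
    by move=> x px; exists (tup1 x).
  rewrite sE in Gpsi.
  have /filter_ex[x [xs [_ /negP]]] : G ([set` s] `&` B s).
    by apply: filterI => //; exact: GB.
  exact.
exists P; split=> // x xP; split.
  have := xP (@PFormula L S 1 n p z); rewrite /psol /defset /mkset vcat1; apply.
  split=> //; apply: filterS (GB [::] I) => y [py _].
  by rewrite /psol /defset /mkset vcat1.
move=> [psi [Apsi fin px]]; have [_ _ /(_ psi Apsi)[Ppsi|Ppsi]] := cP.
  exact: nonalg Ppsi fin.
exact: xP Ppsi px.
Qed.

End Dimension.

Section HStructure.
Variables (L : language) (S : structure (lang_H L)).
Local Notation S0 := (reduct S).
Local Notation H := (Hset (N := S)).
Hypotheses (HS : H_structure S) (geo : geometric_structure S0).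

Let clP := acl_pregeometry geo.1.

Lemma H_structure_types n (p : formula L n.+1) K (z : 'I_n -> S0) (s : seq S0) :
  (forall K' (z : 'I_n -> S0), sat (AtMost K' p) z -> sat (AtMost K p) z) ->
  ~ sat (AtMost K p) z ->
  (exists2 h, H h & sat p (vcons h z) /\ h \notin s) /\
  (exists2 x, ~ acl (range z `|` H) x & sat p (vcons x z)).
Proof.
move=> bound nK; pose A := range z `|` [set` s].
have [x zx||P [cP nP PP]] := @nonalgebraic_type _ _ n z p A; first by left.
  move=> /finite_atmost[K' K'p]; apply: nK; apply: (bound K').
  by rewrite satAtMost.
have finA : finite_dim A.
  apply: finite_dim_finite; rewrite finite_setU -set_tuple_seq; split; exact: finite_seq.
have [[h Hh /PP[ph nAh]] [x nx /PP[px _]]] := HS.2 A finA P cP nP.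
split; [exists h => //; split=> //|exists x => //].
  by apply/negP => hs; apply: nAh; apply: acl_sub; right.
by apply: contra_not nx; apply: (cl_mono clP) => y [?|?]; [left; left|right].
Qed.

Lemma H_structure_dense : Hdense S.
Proof.
move=> n p; have [K bound] := geo.2 n p; exists K => N z.
rewrite satImp !satNeg sat_lift => nK.
rewrite satAtMost => -[s _ sP].
have [[h Hh [ph /negP nhs]] _] := H_structure_types s bound nK.
apply: nhs; apply: sP.
by rewrite /mkset satAnd sat_lift sat_InH vcons0.
Qed.

Lemma H_structure_generic : Hgeneric S.
Proof.
move=> n p; have [K bound] := geo.2 n p; exists K => l lP z.
rewrite satImp satNeg sat_lift => nK.
have [_ [x /sat_not_alg_over_H nx px]] := H_structure_types [::] bound nK.
rewrite satEx; exists x; rewrite satAnd sat_lift satConj; split=> //.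
by apply: List.Forall_impl lP => q /nx.
Qed.

End HStructure.

Section ElementaryMap.
Variables (L : language) (N S : structure (lang_H L)) (e : N -> S).
Hypothesis eE : elementary e.

Lemma elementary_models : models S (theory N).
Proof.
move=> p Np v; have [x0] := dom_nonempty N; pose v0 (i : 'I_0) : N := x0.
by have -> : v = e \o v0 by [apply/funext => -[]]; apply/eE; exact: Np.
Qed.

Lemma reduct_models : models (reduct S) (theory (reduct N)).
Proof.
move=> p Np v; rewrite -sat_lift; apply: elementary_models => w.
by rewrite sat_lift; exact: Np.
Qed.

Lemma elementary_Hdense : Hdense N -> Hdense S.
Proof.
move=> dense n p; have [K h] := dense n p; exists K => k.
exact: models_transfer elementary_models (h k).
Qed.

Lemma elementary_Hgeneric : Hgeneric N -> Hgeneric S.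
Proof.
move=> gen n p; have [K h] := gen n p; exists K => l lP.
exact: models_transfer elementary_models (h l lP).
Qed.

(** A dependence among [c] and elements of [H] is witnessed by a formula over [c],
    hence would be reflected by the elementary map. *)
Lemma elementary_Hfree k (c : 'I_k -> reduct N) :
  Hfree (@acl L (reduct N)) (Hset (N := N)) (range c) ->
  Hfree (@acl L (reduct S)) (Hset (N := S)) (range (e \o c : 'I_k -> reduct S)).
Proof.
move=> Hc h Hh hc /aclU_tuple[s sH [theta [K [hs sK]]]]; set r := size s in theta hs sK *.
pose LH := lang_H L.
pose core := @alg_core L r 1 k predT (fun=> theta) (fun=> K).
pose x_new : formula LH k.+1 :=
  Conj [seq Neg (Equal (Var LH ord0) (Var LH (lift ord0 i))) | i <- enum 'I_k].
pose h_new : formula LH (r + (1 + k)) :=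
  Conj [seq Neg (Equal (Var LH (lshift (1 + k) i)) (Var LH (rshift r (lshift k ord0))))
       | i <- enum 'I_r].
pose dep : formula LH k.+1 :=
  ExN (m := r) (n := k.+1) (And (onH L r 1 k) (And h_new core)).
pose q : formula LH k := Ex (And (InH L ord0) (And x_new dep)).
have qE (S' : structure LH) (v : 'I_k -> reduct S') :
    @sat LH S' _ q v <-> exists x : reduct S', [/\ Hset x, ~ range v x &
      exists t : 'I_r -> reduct S', [/\ forall i, Hset (t i), ~ range t x,
        sat theta (vcons x (vcat t v)) & sat (AtMost K theta) (vcat t v)]].
  have newE n (f : 'I_n -> S') (x : S') :
      (forall i, i \in enum 'I_n -> f i <> x) <-> ~ range f x.
    split=> [h' [i _ fi]|h' i _ fi]; last by apply: h'; exists i.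
    by apply: (h' i); rewrite ?mem_enum.
  have xnE x : @sat LH S' _ x_new (vcons x v) <-> ~ range v x.
    rewrite satConj_map -newE; split=> h' i /h'.
      by rewrite satNeg /sat /= vcons0 vconsS => + xv; apply.
    by rewrite satNeg /sat /= vcons0 vconsS => + xv; apply.
  have hnE x (t : 'I_r -> reduct S') :
      @sat LH S' _ h_new (vcat t (vcat (tup1 x) v)) <-> ~ range t x.
    rewrite satConj_map -newE; split=> h' i /h';
    by rewrite satNeg /sat /= vcat_lshift vcat_rshift vcat_lshift => + xt; apply.
  rewrite satEx; split=> [[x]|[x [Hx xv [t [Ht tx th tK]]]]].
    rewrite !satAnd sat_InH vcons0 => -[Hx [/xnE xv]]; exists x; split=> //.
    move: b; rewrite satExN -[vcons x v]/(vcons (tup1 x ord0) v) -vcat1 => -[t].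
    rewrite !satAnd => -[/(sat_onH t (tup1 x) v) Ht [/hnE tx]].
    by move=> /(sat_alg_core _ _ _ t (tup1 x) v)/(_ ord0 isT)[th tK]; exists t.
  exists x; rewrite !satAnd sat_InH vcons0; split=> //; split; first exact/xnE.
  rewrite satExN; exists t.
  suff : @sat LH S' _ (And (onH L r 1 k) (And h_new core)) (vcat t (vcat (tup1 x) v)).
    by rewrite vcat1.
  rewrite !satAnd; split; first exact/(sat_onH t (tup1 x) v).
  by split; [exact/hnE|apply/(sat_alg_core _ _ _ t (tup1 x) v) => j _].
have : @sat LH S _ q (e \o c).
  apply/qE; exists h; split=> //; exists (seq_tuple s); split=> //.
    by move=> i; have [] : (Hset (N := S) `\ h) (seq_tuple s i)
      by apply: sH; rewrite -range_seq_tuple; exists i.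
  by rewrite range_seq_tuple => /sH[_ /(_ erefl)].
move=> /eE /qE[x [Hx xc [t [Ht tx th tK]]]]; apply: (Hc x Hx xc).
apply/aclP; exists _, (vcat t c); split; last by exists theta, K.
rewrite range_vcat => y [ty|cy]; [right|by left].
split; first by have [i _ <-] := ty.
by move=> yx; apply: tx; rewrite -yx.
Qed.

End ElementaryMap.

(** * Extending tuples of equal type *)

Section Equivalence.
Variables (L : language) (S S' : structure L).

Definition eqv n (v : 'I_n -> S) (v' : 'I_n -> S') :=
  forall p : formula L n, sat p v <-> sat p v'.

Lemma eqv_comp n m (v : 'I_n -> S) (v' : 'I_n -> S') (f : 'I_m -> 'I_n) :
  eqv v v' -> eqv (v \o f) (v' \o f).
Proof. by move=> vv' p; rewrite -(sat_ren p f v) -(sat_ren p f v'). Qed.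

Lemma eqv_behead n x x' (v : 'I_n -> S) (v' : 'I_n -> S') :
  eqv (vcons x v) (vcons x' v') -> eqv v v'.
Proof.
by move=> /(@eqv_comp _ _ _ _ (lift ord0)); rewrite !vcons_tail.
Qed.

Lemma eqv_eq n (v : 'I_n -> S) (v' : 'I_n -> S') i j :
  eqv v v' -> v i = v j -> v' i = v' j.
Proof. by move=> /(_ (Equal (Var L i) (Var L j))) []. Qed.

Lemma eqv_algebraic n x x' (v : 'I_n -> S) (v' : 'I_n -> S') :
  eqv (vcons x v) (vcons x' v') -> algebraic v x -> algebraic v' x'.
Proof.
move=> xx' [p [N [px pN]]]; exists p, N; split; first exact/xx'.
exact/(eqv_behead xx').
Qed.

Lemma eqv_nonalgebraic n x' (v : 'I_n -> S) (v' : 'I_n -> S') (p : formula L n.+1) K :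
  eqv v v' -> ~ acl (range v') x' -> sat p (vcons x' v') -> ~ sat (AtMost K p) v.
Proof.
move=> vv' nx' px' /(vv' (AtMost K p)) pK; apply: nx'.
by apply/acl_rangeP; exists p, K.
Qed.

End Equivalence.

Lemma eqv_sym (L : language) (S S' : structure L) n (v : 'I_n -> S) (v' : 'I_n -> S') :
  eqv v v' -> eqv v' v.
Proof. by move=> vv' p; split=> /vv'. Qed.

Lemma eqv_trans (L : language) (S S' S'' : structure L) n (v : 'I_n -> S)
    (v' : 'I_n -> S') (v'' : 'I_n -> S'') : eqv v v' -> eqv v' v'' -> eqv v v''.
Proof. by move=> vv' vv'' p; rewrite (vv' p). Qed.

Lemma saturated_extend (L : language) (S S' : structure L) (T : set (formula L 0))
    n (v : 'I_n -> S) (v' : 'I_n -> S') x' :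
  infinite_set T -> saturated S T -> eqv v v' ->
  exists x, eqv (vcons x v) (vcons x' v').
Proof.
move=> infT satS vv'.
have [l lx'|x hx] := saturated_realize infT satS (v := v)
    (Gamma := [set p | sat p (vcons x' v')]).
  have : sat (Ex (Conj l)) v' by rewrite satEx; exists x'; rewrite satConj.
  by move=> /vv'; rewrite satEx.
exists x => p; split=> [px|/hx//]; apply: contrapT => npx'.
by have := hx (Neg p) npx'; rewrite satNeg.
Qed.

Section ExtendH.
Variables (L : language) (S : structure (lang_H L)).
Variables (T : set (formula (lang_H L) 0)).
Hypotheses (infT : infinite_set T) (satS : saturated S T).
Hypotheses (dense : Hdense S) (gen : Hgeneric S).
Variable S' : structure L.
Local Notation S0 := (reduct S).
Local Notation H := (Hset (N := S)).
Local Notation LH := (lang_H L).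

(** The common pattern of the extensions below: realize in [S] the L-type of [x']
    transported to the coordinates [f] of [u], together with conditions [extra] in
    the larger language over all of [u].  It suffices to satisfy each formula of
    the type with finitely many of the conditions. *)
Lemma realize_over n k (u : 'I_k -> S0) (f : 'I_n -> 'I_k) (v' : 'I_n -> S') x'
    (extra : set (formula LH k.+1)) :
  (forall (p : formula L n.+1) l, sat p (vcons x' v') -> List.Forall extra l ->
    exists x : S0, sat p (vcons x (u \o f)) /\ @sat LH S _ (Conj l) (vcons x u)) ->
  exists x : S0, eqv (vcons x (u \o f)) (vcons x' v') /\
    forall q, extra q -> @sat LH S _ q (vcons x u).
Proof.
move=> fin_sat; pose up_lift (p : formula L n.+1) := ren (lift_form p) (up f).
have upE p x : @sat LH S _ (up_lift p) (vcons x u) = @sat L S0 _ p (vcons x (u \o f)).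
  by rewrite sat_ren vcons_up sat_lift.
pose Gamma : set (formula LH k.+1) :=
  [set up_lift p | p in [set p | sat p (vcons x' v')]] `|` extra.
have [l Gl|x hx] := @saturated_realize _ S _ infT satS _ u Gamma.
  have [p [l' [px' l'e lE]]] : exists p l', [/\ sat p (vcons x' v'),
      List.Forall extra l' & forall x : S0, sat p (vcons x (u \o f)) ->
        @sat LH S _ (Conj l') (vcons x u) -> @sat LH S _ (Conj l) (vcons x u)].
    elim: l Gl => [|q l IHl] Gl.
      by exists (Neg (Falsum L n.+1)), [::]; split.
    have [Gq /IHl[p [l' [px' l'e lE]]]] : Gamma q /\ List.Forall Gamma l.
      by inversion Gl.
    have [[p1 p1x' <-]|eq] := Gq.
      exists (And p1 p), l'; split=> //; first by rewrite satAnd.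
      move=> x; rewrite satAnd => -[p1x px] /lE; rewrite !satConj => h.
      by constructor; [rewrite upE|exact: h].
    exists p, (q :: l'); split=> //; first by constructor.
    move=> x px; rewrite satConj => h.
    have [qx l'x] : @sat LH S _ q (vcons x u) /\
        List.Forall (fun q => @sat LH S _ q (vcons x u)) l'.
      by inversion h.
    rewrite satConj; constructor=> //; rewrite -satConj.
    by apply: lE => //; rewrite satConj.
  by have [x [px l'x]] := fin_sat p l' px' l'e; exists x; exact: lE.
exists x; split=> [p|q eq]; last by apply: hx; right.
have fwd q : sat q (vcons x' v') -> @sat L S0 _ q (vcons x (u \o f)).
  by move=> qx'; rewrite -upE; apply: hx; left; exists q.
split=> [px|/fwd//]; apply: contrapT => npx'.
by have := fwd (Neg p) npx'; rewrite satNeg.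
Qed.

Variables (n : nat) (v : 'I_n -> S0) (v' : 'I_n -> S').
Hypothesis vv' : eqv v v'.

Lemma extend_any x' : exists x : S0, eqv (vcons x v) (vcons x' v').
Proof.
have [p l px' l0|x [xx' _]] := @realize_over n n v id v' x' set0; last by exists x.
have : sat (Ex p) v by apply/vv'; rewrite satEx; exists x'.
rewrite satEx => -[x px]; exists x; split=> //.
by rewrite satConj; case: l l0 => [|q l] h; [constructor|inversion h].
Qed.

Lemma extend_generic x' : ~ acl (range v') x' ->
  exists2 x : S0, eqv (vcons x v) (vcons x' v') & ~ acl (range v `|` H) x.
Proof.
move=> nx'; have [p l px' lP|x [xx' hx]] :=
  @realize_over n n v id v' x' (@not_alg_over_H L n); last first.
  by exists x => //; apply/sat_not_alg_over_H.
have [K /(_ l lP v)] := gen p; rewrite satImp satNeg sat_lift => h.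
have := h (eqv_nonalgebraic vv' nx' px'); rewrite satEx => -[x].
by rewrite satAnd sat_lift; exists x.
Qed.

(** Avoiding [s] will produce infinitely many realizations in [H]. *)
Lemma extend_H x' (s : seq S0) : ~ acl (range v') x' ->
  exists2 x : S0, eqv (vcons x v) (vcons x' v') & H x /\ x \notin s.
Proof.
move=> nx'; pose u : 'I_(size s + n) -> S0 := vcat (seq_tuple s) v.
have uE : u \o @rshift (size s) n = v by apply/funext => i; rewrite /= /u vcat_rshift.
pose q : formula LH (size s + n).+1 := And (InH L ord0)
  (Conj [seq Neg (Equal (Var LH ord0) (Var LH (lift ord0 (lshift n i))))
        | i <- enum 'I_(size s)]).
have qE (x : S0) : @sat LH S _ q (vcons x u) <-> H x /\ x \notin s.
  rewrite satAnd sat_InH vcons0 satConj_map.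
  have E i : @sat LH S _ (Neg (Equal (Var LH ord0) (Var LH (lift ord0 (lshift n i)))))
      (vcons x u) = (x <> seq_tuple s i).
    by rewrite satNeg /sat /= vcons0 vconsS /u vcat_lshift.
  split=> -[Hx xs]; split=> //.
    apply/negP => /(tnthP (in_tuple s))[i xi]; have := xs i (mem_enum _ i).
    by rewrite E.
  by move=> i _; rewrite E => xi; rewrite xi mem_tnth in xs.
have [p l px' lq|x [xx' hx]] := @realize_over n _ u (@rshift (size s) n) v' x' [set q].
  have [K /(_ (size s) v)] := dense p; rewrite satImp !satNeg sat_lift => h.
  have := h (eqv_nonalgebraic vv' nx' px'); rewrite satAtMost => nfin.
  have [x [[Hx px] xs]] : exists x : S0, (H x /\ sat p (vcons x v)) /\ x \notin s.
    apply: contrapT => nex; apply: nfin; exists s => // x.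
    rewrite /mkset satAnd sat_InH vcons0 sat_lift => Hpx.
    by apply: contrapT => /negP xs; apply: nex; exists x.
  exists x; rewrite uE satConj; split=> //; apply: List.Forall_impl lq => _ ->.
  exact/qE.
by exists x; [rewrite -uE|apply/qE; exact: hx].
Qed.

End ExtendH.

(** * Types of H-independent tuples *)

Section BackAndForth.
Variables (L : language) (S : structure (lang_H L)).
Variables (T : set (formula (lang_H L) 0)).
Hypotheses (infT : infinite_set T) (satS : saturated S T).
Hypotheses (dense : Hdense S) (gen : Hgeneric S).
Local Notation S0 := (reduct S).
Local Notation H := (Hset (N := S)).
Local Notation LH := (lang_H L).
Hypothesis clP : pregeometry (@acl L S0).
Local Notation free A := (Hfree (@acl L S0) H A).

(** The relation preserved by the back-and-forth construction. *)
Definition twins k (v v' : 'I_k -> S0) :=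
  [/\ eqv v v', free (range v), free (range v') & forall i, H (v i) <-> H (v' i)].

Lemma twins_sym k (v v' : 'I_k -> S0) : twins v v' -> twins v' v.
Proof. by move=> [vv' fv fv' Hv]; split=> // [|i]; [exact: eqv_sym|split=> /Hv]. Qed.

Lemma twins_vcons k (v v' : 'I_k -> S0) x x' : twins v v' ->
  eqv (vcons x v) (vcons x' v') -> free (x |` range v) -> free (x' |` range v') ->
  (H x <-> H x') -> twins (vcons x v) (vcons x' v').
Proof.
move=> [_ _ _ Hv] xx' fx fx' Hx; split; rewrite ?range_vcons// => i.
by rewrite /vcons; case: (unliftP ord0 i) => [j|] _.
Qed.

(** An algebraic element outside [H] has its image outside [H] by freeness; an
    element of [H] is sent to [H] by density; an element that is generic over [H]
    is sent to such an element by the extension property. *)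
Lemma twins_step k (v v' : 'I_k -> S0) x : twins v v' ->
  [\/ H x, acl (range v) x | ~ acl (range v `|` H) x] ->
  exists x', twins (vcons x v) (vcons x' v').
Proof.
move=> tw; have [vv' fv fv' Hv] := tw.
have in_range : range v x -> exists x', twins (vcons x v) (vcons x' v').
  move=> [i _ <-]; exists (v' i); apply: twins_vcons => //.
  - have E (w : 'I_k -> S0) : vcons (w i) w = w \o
        (fun j => if unlift ord0 j is Some l then l else i).
      by apply/funext => j; rewrite /vcons /=; case: unlift.
    by rewrite !E; exact: eqv_comp.
  - by apply: Hfree_setU1_cl => //; apply: acl_sub; exists i.
  - by apply: Hfree_setU1_cl => //; apply: acl_sub; exists i.
have [[Hx|nHx] [vx|nvx]] := (pselect (H x), pselect (acl (range v) x)).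
- by move=> _; apply: in_range; exact: Hfree_cl Hx vx.
- move=> _; have [x' xx' [Hx' _]] :=
    extend_H infT satS dense (eqv_sym vv') [::] nvx.
  exists x'; apply: twins_vcons => //; first exact: eqv_sym.
    exact: Hfree_setU1H.
  exact: Hfree_setU1H.
- move=> _; have [x' xx'] := extend_any infT satS (eqv_sym vv') x.
  have {}xx' := eqv_sym xx'.
  have vx' : acl (range v') x'.
    by apply/acl_rangeP; apply: (eqv_algebraic xx'); exact/acl_rangeP.
  exists x'; apply: twins_vcons => //; [exact: Hfree_setU1_cl..|split=> // Hx'].
  have [i _ ix'] := Hfree_cl clP fv' Hx' vx'; case: nHx.
  have := eqv_eq (i := ord0) (j := lift ord0 i) (eqv_sym xx').
  by rewrite !vcons0 !vconsS -ix' => ->//; apply/Hv; rewrite ix'.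
- case=> // nx; have [x' xx' nx'] := extend_generic infT satS gen (eqv_sym vv') nvx.
  exists x'; apply: twins_vcons => //; first exact: eqv_sym.
  + exact: Hfree_setU1_generic.
  + exact: Hfree_setU1_generic.
  + by split=> // Hx'; case: nx'; apply: acl_sub; right.
Qed.

Lemma twins_seq (s : seq S0) : [set` s] `<=` H -> forall k (v v' : 'I_k -> S0),
  twins v v' -> exists l (w w' : 'I_l -> S0) f,
    [/\ twins w w', v = w \o f, v' = w' \o f & [set` s] `<=` range w].
Proof.
elim: s => [|x s IHs] sH k v v' vv'; first by exists k, v, v', id; split.
have [y ys|l [w [w' [f [ww' vE v'E sw]]]]] := IHs _ k v v' vv'.
  by apply: sH; rewrite /= inE ys orbT.
have [|x' xx'] := twins_step (x := x) ww'.
  by constructor 1; apply: sH; exact: mem_head.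
exists l.+1, (vcons x w), (vcons x' w'), (lift ord0 \o f); split=> //.
- by rewrite compA vcons_tail.
- by rewrite compA vcons_tail.
- move=> y; rewrite range_vcons /= inE => /orP[/eqP->|/sw]; first by left.
  by right.
Qed.

(** An element that depends on [H] falls under [twins_step] once the elements of
    [H] on which it depends have been added. *)
Lemma twins_extend k (v v' : 'I_k -> S0) x : twins v v' ->
  exists l (w w' : 'I_l -> S0) f j,
    [/\ twins w w', v = w \o f, v' = w' \o f & x = w j].
Proof.
move=> vv'; have [l [w [w' [f [ww' vE v'E xw]]]]] : exists l (w w' : 'I_l -> S0) f,
    [/\ twins w w', v = w \o f, v' = w' \o f &
        [\/ H x, acl (range w) x | ~ acl (range w `|` H) x]].
  have [|nx] := pselect (acl (range v `|` H) x); last first.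
    by exists k, v, v', id; split=> //; constructor 3.
  move=> /aclU_tuple[s sH /acl_rangeP sx].
  have [l [w [w' [f [ww' vE v'E sw]]]]] := twins_seq sH vv'.
  exists l, w, w', f; split=> //; constructor 2; apply: (cl_mono clP) sx.
  rewrite range_vcat range_seq_tuple vE => y [/sw//|[i _ <-]].
  by exists (f i).
have [x' xx'] := twins_step ww' xw.
exists l.+1, (vcons x w), (vcons x' w'), (lift ord0 \o f), ord0; split=> //.
- by rewrite compA vcons_tail.
- by rewrite compA vcons_tail.
- by rewrite vcons0.
Qed.

Lemma unlift_term n (t : term LH n) : exists t0 : term L n,
  forall v : 'I_n -> S0, @Defs.eval LH S n v t = Defs.eval v t0.
Proof.
elim: t => [i|g a IHa]; first by exists (Var L i).
exists (@App L n g (fun j => sval (cid (IHa j)))) => v /=.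
by congr fint; apply/funext => j; case: cid => t0 /= ->.
Qed.

Lemma acl_eval n (t : term L n) (v : 'I_n -> S0) : acl (range v) (Defs.eval v t).
Proof.
have E y : sat (Equal (Var L ord0) (ren_term (lift ord0) t)) (vcons y v) =
    (y = Defs.eval v t).
  by rewrite /sat /= vcons0 eval_ren vcons_tail.
apply/acl_rangeP; exists (Equal (Var L ord0) (ren_term (lift ord0) t)), 1%N.
rewrite E satAtMost; split=> //; exists [:: Defs.eval v t] => // y.
by rewrite /mkset E => ->; exact: mem_head.
Qed.

(** The value of a term is algebraic over [v], so by freeness it lies in [H] only
    if it equals some [v i], and this is a statement of the L-type. *)
Lemma twins_H_eval k (v v' : 'I_k -> S0) (t : term L k) : twins v v' ->
  H (Defs.eval v t) -> H (Defs.eval v' t).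
Proof.
move=> [vv' fv fv' Hv] Ht; have [i _ vi] := Hfree_cl clP fv Ht (acl_eval t v).
have [/(_ vi) <- _] := vv' (Equal (Var L i) t).
by apply/Hv; rewrite vi.
Qed.

(** Tuples that are free over [H], realize the same type in the reduct and meet
    [H] in the same places realize the same type: each quantifier is handled by
    extending both tuples, first by the elements of [H] on which the new element
    depends and then by the new element itself. *)
Lemma twins_sat n (phi : formula LH n) k (v v' : 'I_k -> S0) (f : 'I_n -> 'I_k) :
  twins v v' -> @sat LH S _ phi (v \o f) <-> @sat LH S _ phi (v' \o f).
Proof.
elim: phi k v v' f => [m|m s t|m r a|m p IHp q IHq|m p IHp] k v v' f vv'.
- by [].
- have [[s0 s0E] [t0 t0E]] := (unlift_term s, unlift_term t).
  rewrite /sat /= !s0E !t0E; have [/(@eqv_comp _ _ _ _ _ _ _ f)] := vv'.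
  by move=> /(_ (Equal s0 t0)).
- have a0 j := cid (unlift_term (a j)).
  case: r a a0 => [r|] a a0.
    have E (w : 'I_m -> S0) : @sat LH S _ (@Atom LH m (Some r) a) w =
        @sat L S0 _ (@Atom L m r (fun j => sval (a0 j))) w.
      rewrite /sat /=; congr (@rint L S0); apply/funext => j.
      by case: (a0 j) => t0 /= ->.
    by rewrite !E; have [/(@eqv_comp _ _ _ _ _ _ _ f)] := vv'.
  have E (w : 'I_m -> S0) : @sat LH S _ (@Atom LH m None a) w =
      H (Defs.eval w (sval (a0 ord0))).
    rewrite /sat /= /Hset /mkset; congr (@rint LH S None); apply/funext => j.
    by rewrite (ord1 j); case: (a0 ord0) => t0 /= ->.
  rewrite !E -(eval_ren f v) -(eval_ren f v').
  by split; apply: twins_H_eval => //; exact: twins_sym.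
- by rewrite !satImp (IHp _ v v' f vv') (IHq _ v v' f vv').
- have all_twins (w w' : 'I_k -> S0) : twins w w' ->
      @sat LH S _ (All p) (w \o f) -> @sat LH S _ (All p) (w' \o f).
    move=> ww' pw x'.
    have [l [u' [u [g [j [uu' -> wE ->]]]]]] := twins_extend x' (twins_sym ww').
    pose h (i : 'I_m.+1) := if unlift ord0 i is Some i' then g (f i') else j.
    have E (z : 'I_l -> S0) : @vcons LH S _ (z j) ((z \o g) \o f) = z \o h.
      by apply/funext => i; rewrite /vcons /h /=; case: unlift.
    have := pw (u j); rewrite wE.
    by rewrite (E u) (E u') => /(IHp _ _ _ _ uu').
  by split; apply: all_twins => //; exact: twins_sym.
Qed.

End BackAndForth.

(** * Lower bounds for the SU-rank *)

(** Each new value is chosen outside the list of the previous ones. *)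
Lemma infinite_sequence (A : eqType) (P : A -> Prop) :
  (forall s : seq A, exists2 x, P x & x \notin s) ->
  exists2 f : nat -> A, injective f & forall i, P (f i).
Proof.
move=> avoid; pose g s := sval (cid2 (avoid s)).
have gP s : P (g s) by rewrite /g; case: cid2.
have gs s : g s \notin s by rewrite /g; case: cid2.
pose l n := iter n (fun s => g s :: s) [::].
have lt_l i j : (i < j)%N -> g (l i) \in l j.
  elim: j => // j IHj; rewrite ltnS leq_eqVlt => /orP[/eqP->|/IHj].
    by rewrite /l /= mem_head.
  by rewrite /l /= inE orbC => ->.
exists (fun n => g (l n)) => // i j ij; apply/eqP; case: ltngtP => // [/lt_l|/lt_l].
  by rewrite ij (negbTE (gs _)).
by rewrite -ij (negbTE (gs _)).
Qed.

Section TypeOf.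
Variables (L : language) (S : structure L).

Definition type_of (A : set S) n (a : 'I_n -> S) : set (pformula S n) :=
  [set psi | has_par A psi /\ psol psi a].

Lemma complete_type_of A n (a : 'I_n -> S) : complete_type A (type_of A a).
Proof.
split=> [psi []//|s _ sp|psi Apsi]; first by exists a => psi /sp[].
have [|] := pselect (psol psi a); first by left.
by right.
Qed.

Lemma divides_subset A B n (psi : pformula S n) :
  A `<=` B -> divides B psi -> divides A psi.
Proof.
move=> AB [r [b [bpsi incons]]]; exists r, b; split=> // i chi Achi.
by apply: bpsi; exact: subset_trans Achi AB.
Qed.

(** A formula that forks over the larger base forks over the smaller one, so the
    same forking chain can be used. *)
Lemma SU_ge_subset (T : set (formula L 0)) A B n (p q : set (pformula S n)) k :
  A `<=` B -> p `<=` q -> SU_ge T B q k -> SU_ge T A p k.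
Proof.
case: k => // k AB pq [B' [q' [[BB' B'T cq'] [qq' [psi q'psi [l [chi [div cov]]]] SUq']]]].
exists B', q'; split; split=> //; first exact: subset_trans BB'.
  exact: subset_trans qq'.
by exists psi => //; exists l, chi; split=> // j; exact: divides_subset (div j).
Qed.

End TypeOf.

Section LowerBound.
Variables (L : language) (S : structure (lang_H L)).
Variables (T : set (formula (lang_H L) 0)).
Hypotheses (infT : infinite_set T) (satS : saturated S T).
Hypotheses (dense : Hdense S) (gen : Hgeneric S).
Local Notation S0 := (reduct S).
Local Notation H := (Hset (N := S)).
Local Notation LH := (lang_H L).
Hypothesis clP : pregeometry (@acl L S0).
Local Notation free A := (Hfree (@acl L S0) H A).

(** An element of [H] outside a free base is not algebraic over it, so density
    gives infinitely many elements of [H] with the same L-type; these are conjugate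
    by [twins_sat]. *)
Lemma twins_conjugates k (b : 'I_k -> S0) h : free (range b) -> H h -> ~ range b h ->
  exists2 f : nat -> S0, injective f & forall i, twins (vcons (f i) b) (vcons h b).
Proof.
move=> fb Hh nbh.
have nb : ~ acl (range b) h by move=> /(Hfree_cl clP fb Hh)/nbh.
have bb : twins b b by split=> [p||| i].
have [|f injf fP] := @infinite_sequence S0 (fun x => twins (vcons x b) (vcons h b));
  last by exists f.
move=> s; have [bb' _ _ _] := bb.
have [x xh [Hx xs]] := extend_H infT satS dense bb' s nb.
exists x => //; apply: twins_vcons => //; exact: Hfree_setU1H.
Qed.

Lemma twins_same_type k (b : 'I_k -> S0) h h' : twins (vcons h' b) (vcons h b) ->
  same_type (S := S) (range b) (vcons h' b) (vcons h b).
Proof.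
move=> tw psi par_b; have [g gE] := range_comp_exists par_b.
pose f i := match fintype.split i with inl j => j | inr j => lift ord0 (g j) end.
have E x : @vcat LH S _ _ (@vcons LH S k x b) (pf_par psi) = vcons x b \o f.
  rewrite gE; apply/funext => i; rewrite /vcat /f /=.
  by case: fintype.split => j /=; rewrite ?vconsS.
by rewrite /psol /defset /mkset !E; exact: (twins_sat infT satS dense gen clP _ _ tw).
Qed.

Section Witness.
Variables (m k r : nat) (J : pred 'I_m).
Variables (theta : 'I_m -> formula L (r + k.+1).+1) (N : 'I_m -> nat).
Let alg := AlgH J theta N.

Definition to_front (i : 'I_(m + k.+1)) : 'I_(m + k).+1 :=
  match fintype.split i with
  | inl j => lift ord0 (lshift k j)
  | inr i' => if unlift ord0 i' is Some j then lift ord0 (rshift m j) else ord0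
  end.

Definition skip_mid (i : 'I_(m + k)) : 'I_(m + k.+1) :=
  match fintype.split i with
  | inl j => lshift k.+1 j
  | inr j => rshift m (lift ord0 j)
  end.

(** In the variables [(x, y, b)]: [y] is one of at most [r.+1] elements of [H]
    that occur in an [r.+1]-tuple of [H] over which [x] is algebraic as
    prescribed by [theta] and [N]. *)
Definition in_support : formula LH (m + k.+1) :=
  let p := And (InH L ord0) (ren alg to_front) in
  And (ren p (fun i => if unlift ord0 i is Some j then skip_mid j else rshift m ord0))
      (ren (AtMost r.+1 p) skip_mid).

Lemma sat_in_support (x : 'I_m -> S0) (y : S0) (b : 'I_k -> S0) :
  @sat LH S _ in_support (vcat x (vcons y b)) <->
  (H y /\ @sat LH S _ alg (vcat x (vcons y b))) /\
  atmost r.+1 [set y' | H y' /\ @sat LH S _ alg (vcat x (vcons y' b))].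
Proof.
have skipE z : @vcat LH S _ _ x (@vcons LH S _ z b) \o skip_mid = vcat x b.
  apply/funext => i; rewrite /= /skip_mid [RHS]/vcat.
  by case: fintype.split => j; rewrite ?vcat_lshift ?vcat_rshift ?vconsS.
have frontE z : @vcons LH S _ z (@vcat LH S _ _ x b) \o to_front = vcat x (vcons z b).
  apply/funext => i; rewrite /= /to_front [RHS]/vcat.
  case: fintype.split => j; first by rewrite vconsS vcat_lshift.
  rewrite [RHS]/vcons; case: unlift => [j'|]; last by rewrite vcons0.
  by rewrite vconsS vcat_rshift.
have pickE z : @vcat LH S _ _ x (@vcons LH S _ z b) \o
    (fun i => if unlift ord0 i is Some j then skip_mid j else rshift m ord0) =
    vcons z (vcat x b).
  apply/funext => i; rewrite /= [RHS]/vcons; case: unlift => [j|].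
    by rewrite -(skipE z).
  by rewrite vcat_rshift vcons0.
rewrite satAnd !sat_ren skipE pickE satAtMost satAnd sat_InH vcons0 sat_ren frontE.
have -> : [set y0 | @sat LH S _ (And (InH L ord0) (ren alg to_front))
    (vcons y0 (vcat x b))] = [set y' | H y' /\ @sat LH S _ alg (vcat x (vcons y' b))].
  by apply/funext => z; rewrite /mkset satAnd sat_InH vcons0 sat_ren frontE.
by [].
Qed.

(** Dividing is witnessed by infinitely many conjugates of [h] over [b]: the last
    conjunct of the formula ties each [x] to at most [r.+1] of them. *)
Lemma in_support_divides (b : 'I_k -> S0) h :
  free (range b) -> H h -> ~ range b h ->
  divides (S := S) (range b) (@PFormula LH S m _ in_support (vcons h b)).
Proof.
move=> fb Hh nbh; have [f injf fP] := twins_conjugates fb Hh nbh.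
exists r.+2, (fun i => vcons (f i) b); split=> [i|s us sr [x xs]].
  exact: twins_same_type.
have /sat_in_support[_ few] : @sat LH S _ in_support (vcat x (vcons (f (head 0 s)) b)).
  by apply: xs; case: (s) sr => // i t _; exact: mem_head.
have : atmost r.+1 [set` map f s].
  apply: atmostW few => y /= /mapP[i si ->].
  by have /sat_in_support[] := xs i si.
by move=> /atmost_size; rewrite map_inj_uniq // size_map sr ltnn => /(_ us).
Qed.

End Witness.

(** An element [y] of [H] that occurs in a generating tuple of the size of the
    support belongs to the support, because the support is contained in that
    tuple.  Hence [a] satisfies [in_support] with [h], and [h] is algebraic over
    [a] and [b]. *)
Lemma support_forks m (a : 'I_m -> S0) (J : pred 'I_m) k (b : 'I_k -> S0) h s :
  free (range b) ->
  is_support (@acl L S0) H (range b) [set a j | j in [set j | J j]] (h :: s) ->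
  exists2 psi, type_of (S := S) (h |` range b) a psi & forks (S := S) (range b) psi.
Proof.
move=> fb supp; have [uF FH aF min_F] := supp.
have Hh : H h by apply: FH; exact: mem_head.
have nbh : ~ range b h by apply: (support_notin clP supp); exact: mem_head.
have alg j : exists (theta : formula L (size s + k.+1).+1) (N : nat), J j ->
    sat theta (vcons (a j) (vcat (seq_tuple s) (vcons h b))) /\
    sat (AtMost N theta) (vcat (seq_tuple s) (vcons h b)).
  have [Jj|nJ] := pselect (J j); last by exists (Falsum _ _), 0%N.
  have : acl (range (vcat (seq_tuple s) (vcons h b))) (a j).
    apply: (cl_mono clP) (aF (a j) _); last by exists j.
    rewrite range_vcat range_vcons range_seq_tuple => x [bx|]; first by right; right.
    by rewrite /= inE => /orP[/eqP->|]; [right; left|left].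
  by move=> /acl_rangeP[theta [N c]]; exists theta, N.
pose theta j := sval (cid (alg j)).
have [N NP] : exists N, forall j, J j ->
    sat (theta j) (vcons (a j) (vcat (seq_tuple s) (vcons h b))) /\
    sat (AtMost (N j) (theta j)) (vcat (seq_tuple s) (vcons h b)).
  exists (fun j => sval (cid (svalP (cid (alg j))))) => j.
  exact: (svalP (cid (svalP (cid (alg j))))).
exists (@PFormula LH S m _ (in_support J theta N) (vcons h b)); last first.
  exists 1%N, (fun=> @PFormula LH S m _ (in_support J theta N) (vcons h b)).
  by split=> [j|x xs]; [exact: in_support_divides|exists ord0].
split; first by rewrite /has_par /= range_vcons.
apply/sat_in_support; split.
  split=> //; apply/sat_AlgH; exists (seq_tuple s); split=> // i.
  by apply: FH; rewrite /= inE mem_tnth orbT.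
exists (h :: s) => // y [Hy /sat_AlgH[t [Ht ty]]].
have F_sub : [set` h :: s] `<=` y |` range t.
  apply: min_F => [x [->//|[i _ <-]//]|_ [j Jj <-]]; have [tj tN] := ty j Jj.
  apply: (cl_mono clP) (_ : acl (range (vcat t (vcons y b))) (a j)).
    rewrite range_vcat range_vcons => x [tx|[->|bx]]; [|by right; left|by left].
    by right; right.
  by apply/acl_rangeP; exists (theta j), (N j).
apply: contrapT => /negP nyF.
have /(uniq_leq_size uF) : {subset h :: s <= tuple_seq t}.
  move=> x xF; have [xy|] := F_sub x xF; first by rewrite -[y]xy xF in nyF.
  by rewrite -set_tuple_seq.
by rewrite /= size_map size_enum_ord ltnn.
Qed.

(** Adding the elements of the support to the base one at a time gives a chain of
    forking extensions. *)
Lemma SU_ge_support m (a : 'I_m -> S0) (J : pred 'I_m) s k (b : 'I_k -> S0) :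
  free (range b) ->
  is_support (@acl L S0) H (range b) [set a j | j in [set j | J j]] s ->
  SU_ge (S := S) T (range b) (type_of (S := S) (range b) a) (size s).
Proof.
elim: s k b => //= h s IHs k b fb supp; have [psi hpsi psi_forks] := support_forks fb supp.
have Hh : H h by have [_ FH _ _] := supp; apply: FH; exact: mem_head.
exists (h |` range b), (type_of (S := S) (h |` range b) a); split; split.
- by move=> x; right.
- apply: finite_card_le => //; rewrite finite_setU -set_tuple_seq.
  by split=> //; exact: finite_seq.
- exact: complete_type_of.
- by move=> chi [par_b sol]; split=> // x /par_b; right.
- by exists psi.
- rewrite -range_vcons; apply: IHs; rewrite range_vcons; first exact: Hfree_setU1H.
  exact: support_behead.
Qed.

End LowerBound.

(** * Nowhere triviality *)

Lemma eqv_models (L : language) (M S : structure L) (v : 'I_0 -> S) (w : 'I_0 -> M) :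
  models S (theory M) -> eqv v w.
Proof.
move=> SM p; have wE w' : w' = w by apply/funext => -[].
split=> [pv|pw]; last by apply: SM => w'; rewrite (wE w').
apply: contrapT => npw; suff: sat (Neg p) v by rewrite satNeg.
by apply: SM => w'; rewrite (wE w') satNeg.
Qed.

Lemma eqv_swap (L : language) (S S' : structure L) n x y x' y'
    (v : 'I_n -> S) (v' : 'I_n -> S') :
  eqv (vcons x (vcons y v)) (vcons x' (vcons y' v')) ->
  eqv (vcons y (vcons x v)) (vcons y' (vcons x' v')).
Proof. by move=> /(@eqv_comp _ _ _ _ _ _ _ (@swap01 n)); rewrite !vcons_swap01. Qed.

Lemma eqv_swap_tail (L : language) (S S' : structure L) n x y z x' y' z'
    (v : 'I_n -> S) (v' : 'I_n -> S') :
  eqv (vcons x (vcons y (vcons z v))) (vcons x' (vcons y' (vcons z' v'))) ->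
  eqv (vcons x (vcons z (vcons y v))) (vcons x' (vcons z' (vcons y' v'))).
Proof.
move=> /(@eqv_comp _ _ _ _ _ _ _ (up (@swap01 n))).
by rewrite !vcons_up !vcons_swap01.
Qed.

Lemma eqv_acl (L : language) (S S' : structure L) n x x' (v : 'I_n -> S) (v' : 'I_n -> S') :
  eqv (vcons x v) (vcons x' v') -> acl (range v') x' -> acl (range v) x.
Proof.
by move=> /eqv_sym xx' /acl_rangeP ax; apply/acl_rangeP; exact: eqv_algebraic xx' ax.
Qed.

Section GenericSupport.
Variables (L : language) (S : structure (lang_H L)).
Variables (T : set (formula (lang_H L) 0)).
Hypotheses (infT : infinite_set T) (satS : saturated S T).
Hypotheses (dense : Hdense S) (gen : Hgeneric S).
Local Notation S0 := (reduct S).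
Local Notation H := (Hset (N := S)).
Local Notation LH := (lang_H L).
Variable M : structure L.
Hypotheses (geoM : geometric_structure M) (S_M : models S0 (theory M)).
Hypotheses (trivM : nowhere_trivial (theory M)) (infTM : infinite_set (theory M)).
Local Notation free A := (Hfree (@acl L S0) H A).

Let clP : pregeometry (@acl L S0) := acl_pregeometry (geometric_models S_M geoM).1.

(** The type of [a] over [v] is copied into the saturated model in which nowhere
    triviality is given; the two tuples found there are then reduced to two
    elements by [cl_nontrivial]. *)
Lemma nowhere_trivial_config k (v : 'I_k -> S0) a : ~ acl (range v) a ->
  exists (S1 : structure L) (v1 : 'I_k -> S1) a1 (d : seq S1) y z,
  [/\ pregeometry (@acl L S1), eqv (vcons a v) (vcons a1 v1),
      ~ acl (y |` (range v1 `|` [set` d])) a1, ~ acl (z |` (range v1 `|` [set` d])) a1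
    & acl (y |` (z |` (range v1 `|` [set` d]))) a1].
Proof.
move=> na; have [S1 [S1_M S1_sat S1_triv]] := trivM.
have clP1 := acl_pregeometry (geometric_models S1_M geoM).1.
have copy n (w : 'I_n -> S0) : exists w1 : 'I_n -> S1, eqv w w1.
  elim: n w => [|n IHn] w.
    have [x0] := dom_nonempty S1; have [m0] := dom_nonempty M.
    exists (fun=> x0); apply: (@eqv_trans _ _ M _ _ _ (fun=> m0)).
      exact: eqv_models.
    by apply: eqv_sym; exact: eqv_models.
  have [w1 ww1] := IHn (w \o lift ord0).
  have [x xw] := saturated_extend (w ord0) infTM S1_sat (eqv_sym ww1).
  by exists (vcons x w1); rewrite -[w]vcons_eta; exact: eqv_sym.
have [v1 vv1] := copy k v.
have [a1 aa1] := saturated_extend a infTM S1_sat (eqv_sym vv1).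
have na1 : ~ acl (range v1) a1 by apply: contra_not na; apply: eqv_acl; exact: eqv_sym.
have v1T : range v1 #<= theory M.
  by apply: finite_card_le => //; rewrite -set_tuple_seq; exact: finite_seq.
have [psi [par_psi psi_a] fin|a2 a2P [n [b [m [c [bP cP abc]]]]]] :=
  S1_triv _ v1T _ (complete_type_of (range v1) (tup1 a1)).
  by apply: na1; exists psi.
have a21 : eqv (vcons a2 v1) (vcons a1 v1).
  have fwd q : sat q (vcons a1 v1) -> sat q (vcons a2 v1).
    have := a2P (@PFormula L S1 1 k q v1).
    rewrite /psol /defset /mkset vcat1 => h qa; apply: h; split=> //.
    by rewrite /psol /defset /mkset vcat1.
  move=> q; split=> [qa2|/fwd//]; apply: contrapT => nqa1.
  by have := fwd (Neg q) nqa1; rewrite satNeg.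
have na2 : ~ acl (range v1) a2 by apply: contra_not na1; apply: eqv_acl; exact: eqv_sym.
have nb := perp_tup1 clP1 na2 bP; have nc := perp_tup1 clP1 na2 cP.
rewrite -(set_tuple_seq b) in nb abc; rewrite -(set_tuple_seq c) in nc abc.
have [d [y [z [ny nz yz]]]] := cl_nontrivial clP1 nb nc abc.
exists S1, v1, a2, d, y, z; split=> //.
exact: eqv_trans (eqv_sym aa1) (eqv_sym a21).
Qed.

(** A base over which [a] is generic can be copied into [S] along [a] so that it
    stays free, adds no element of [H] and leaves [a] generic over it and [H]:
    its algebraic elements are forced, and the others are taken generic over
    [a] and [H]. *)
Lemma generic_copy (S1 : structure L) (d : seq S1) : pregeometry (@acl L S1) ->
  forall k (v : 'I_k -> S0) a (v1 : 'I_k -> S1) a1,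
  eqv (vcons a v) (vcons a1 v1) -> free (range v) -> ~ acl (range v `|` H) a ->
  ~ acl (range v1 `|` [set` d]) a1 ->
  exists l (w : 'I_l -> S0) (w1 : 'I_l -> S1),
    [/\ eqv (vcons a w) (vcons a1 w1), free (range w), ~ acl (range w `|` H) a,
        range v `<=` range w /\ range w `&` H `<=` range v &
        range w1 = range v1 `|` [set` d]].
Proof.
move=> clP1; elim: d => [|x1 d IHd] k v a v1 a1 aa1 fv na na1.
  exists k, v, v1; split=> //; first by split=> // x [].
  by apply/seteqP; split=> x; [left|case].
have dE : range v1 `|` [set` x1 :: d] = (x1 |` range v1) `|` [set` d].
  apply/seteqP; split=> y /=; rewrite inE.
    by move=> [?|/orP[/eqP->|?]]; [left; right|left; left|right].
  by move=> [[->|?]|->]; rewrite ?eqxx ?orbT; [right|left|right].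
have [x xx1 [fx nax vH]] : exists2 x, eqv (vcons x (vcons a v)) (vcons x1 (vcons a1 v1)) &
    [/\ free (x |` range v), ~ acl ((x |` range v) `|` H) a &
        (x |` range v) `&` H `<=` range v].
  have [x1alg|nx1alg] := pselect (acl (range v1) x1).
    have [x xx1] := extend_any infT satS aa1 x1.
    have xalg : acl (range v) x.
      apply: (@eqv_acl _ _ _ _ x x1 v v1) => //.
      move: xx1 => /eqv_swap /eqv_behead; exact.
    exists x => //; split; first exact: Hfree_setU1_cl.
      apply: contra_not na; apply: (cl_trans clP) => y [[->|?]|?].
      - by apply: (cl_mono clP) xalg => z; left.
      - by apply: acl_sub; left.
      - by apply: acl_sub; right.
    by move=> y [[->|//] Hx]; exact: (Hfree_cl clP fv).
  have [|x xx1 nx] := extend_generic infT satS gen aa1 (x' := x1).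
    rewrite range_vcons => x1a; apply: na1.
    apply: (cl_mono clP1) (cl_exchange clP1 x1a nx1alg).
    by move=> y [->|?]; [right; exact: mem_head|left].
  rewrite range_vcons in nx; exists x => //; split.
  - apply: Hfree_setU1_generic => //; apply: contra_not nx; apply: (cl_mono clP).
    by move=> y [?|?]; [left; right|right].
  - rewrite -setUA => ax; apply: nx; rewrite -setUA; exact: (cl_exchange clP) ax na.
  - by move=> y [[->|//] Hx]; case: nx; apply: acl_sub; right.
have {}xx1 : eqv (vcons a (vcons x v)) (vcons a1 (vcons x1 v1)) by exact: eqv_swap.
rewrite dE -range_vcons in na1.
have [||l [w [w1 [ww1 fw naw [vw wH] w1E]]]] := IHd _ _ _ _ _ xx1 _ _ na1.
- by rewrite range_vcons.
- by rewrite range_vcons.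
exists l, w, w1; split=> //; last by rewrite w1E range_vcons dE.
rewrite range_vcons in vw wH; split; first by move=> y vy; apply: vw; right.
by move=> y [wy Hy]; apply: vH; split=> //; apply: wH.
Qed.

(** The configuration [a = h + g], up to algebraic dependence.  In the copy of the
    base, [h] is not algebraic over [a], so that it can be taken in [H]; then [g]
    is algebraic over [a] and [h]. *)
Lemma generic_step k (v : 'I_k -> S0) a (s : seq S0) :
  free (range v) -> ~ acl (range v `|` H) a ->
  exists l (w : 'I_l -> S0) h g,
  [/\ range v `<=` range w, range w `&` H `<=` range v, free (range w)
    & ~ acl (range w `|` H) a] /\
  [/\ H h, h \notin s, ~ range w h & ~ acl (range w `|` H) g] /\
  (acl (g |` (h |` range w)) a /\ acl (g |` (a |` range w)) h).
Proof.
move=> fv na; have nav : ~ acl (range v) a.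
  by apply: contra_not na; apply: (cl_mono clP) => x; left.
have [S1 [v1 [a1 [d [y [z [clP1 aa1 ny nz yz]]]]]]] := nowhere_trivial_config nav.
have [|l [w [w1 [ww1 fw naw [vw wH] w1E]]]] := generic_copy clP1 aa1 fv na (d := d).
  by apply: contra_not ny; apply: (cl_mono clP1) => x; right.
rewrite -w1E in ny nz yz.
have nyw : ~ acl (range (vcons a1 w1)) y.
  rewrite range_vcons => ya; have [yw|nyw] := pselect (acl (range w1) y).
    apply: nz; apply: (cl_trans clP1 _ yz) => x [->|?]; last exact: acl_sub.
    by apply: (cl_mono clP1) yw => ?; right.
  exact/ny/(cl_exchange clP1 ya nyw).
have [h hy [Hh]] := extend_H infT satS dense ww1 (s ++ tuple_seq w) nyw.
rewrite mem_cat negb_or => /andP[hs /negP hw].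
have [g gz] := extend_any infT satS hy z.
have alg_a : acl (g |` (h |` range w)) a.
  have /eqv_swap := eqv_swap_tail gz.
  move=> /eqv_acl; rewrite !range_vcons; apply.
  by apply: (cl_mono clP1) yz => x [->|[->|?]]; [right; left|left|right; right].
have alg_h : acl (g |` (a |` range w)) h.
  have := eqv_swap gz.
  move=> /eqv_acl; rewrite !range_vcons; apply.
  have := cl_exchange clP1 yz nz; apply: (cl_mono clP1).
  by move=> x [->|[->|?]]; [right; left|left|right; right].
exists l, w, h, g; do ! split=> //.
  by rewrite -set_tuple_seq.
move=> gw; apply: naw; apply: (cl_trans clP _ alg_a) => x [->//|[->|?]].
  by apply: acl_sub; right.
by apply: acl_sub; left.
Qed.

(** The configuration is repeated with [g] in the place of [a]: the support of [a]
    consists of [h] and the support of [g].  The list [s] keeps the elements of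
    the support distinct. *)
Lemma generic_support r k (v : 'I_k -> S0) a (s : seq S0) :
  free (range v) -> ~ acl (range v `|` H) a ->
  exists l (w : 'I_l -> S0) F,
  [/\ range v `<=` range w, range w `&` H `<=` range v & free (range w)] /\
  [/\ is_support (@acl L S0) H (range w) [set a] F, size F = r
    & forall h, h \in F -> h \notin s].
Proof.
elim: r k v a s => [|r IHr] k v a s fv na.
  exists k.+1, (vcons a v), [::]; rewrite range_vcons; do ! split=> //.
  - by move=> x [[->|//] Ha]; case: na; apply: acl_sub; right.
  - exact: Hfree_setU1_generic.
  - by move=> _ ->; apply: acl_sub; left; left.
have [l [w [h [g [[vw wH fw naw] [[Hh hs hw ng] [alg_a alg_h]]]]]]] := generic_step s fv na.
have [l' [w' [F [[ww' w'H fw'] [[uF FH gF min_F] szF Fs]]]]] := IHr _ w g (h :: s) fw ng.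
have hF : h \notin F by apply/negP => /Fs; rewrite mem_head.
have hw' : ~ range w' h by move=> w'h; apply: hw; exact: w'H.
have {}gF : acl (range w' `|` [set` F]) g by exact: gF.
exists l', w', (h :: F); split.
  split=> //; first exact: subset_trans ww'.
  by move=> x [w'x Hx]; apply: wH; split=> //; apply: w'H.
split=> //=; last first.
- move=> x; rewrite inE => /orP[/eqP->//|/Fs]; by rewrite inE negb_or => /andP[].
- by rewrite szF.
split=> /=.
- by rewrite hF.
- by move=> x; rewrite /= inE => /orP[/eqP->//|/FH].
- move=> _ ->; apply: (cl_trans clP _ alg_a) => x [->|[->|wx]].
  + apply: (cl_mono clP) gF => y [?|yF]; first by left.
    by right; rewrite /= inE yF orbT.
  + by apply: acl_sub; right; exact: mem_head.
  + by apply: acl_sub; left; exact: ww'.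
move=> F' F'H aF'; have {}aF' : acl (range w' `|` F') a by exact: aF'.
have F'h : F' h.
  apply: contrapT => nF'h; apply: (fw' h Hh hw').
  apply: (cl_trans clP _ alg_h) => x [->|[->|wx]].
  - apply: (cl_mono clP) gF => y [?|yF]; first by left.
    by right; split; [exact: FH|move=> yh; rewrite -yh yF in hF].
  - apply: (cl_mono clP) aF' => y [?|F'y]; first by left.
    by right; split; [exact: F'H|move=> yh; apply: nF'h; rewrite -yh].
  - by apply: acl_sub; left; exact: ww'.
have nha : ~ acl (h |` range w) a.
  by apply: contra_not naw; apply: (cl_mono clP) => x [->|?]; [right|left].
have F_F' : [set` F] `<=` F'.
  apply: min_F => // _ ->; have := cl_exchange clP alg_a nha.
  apply: (cl_trans clP) => x [->//|[->|wx]].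
    by apply: acl_sub; right.
  by apply: acl_sub; left; exact: ww'.
by move=> x; rewrite /= inE => /orP[/eqP->//|/F_F'].
Qed.

End GenericSupport.

(** * Counting sets covered by algebraic formulas *)

Lemma atmost_setU (A : choiceType) N1 N2 (P Q : set A) :
  atmost N1 P -> atmost N2 Q -> atmost (N1 + N2) (P `|` Q).
Proof.
move=> [s sN1 Ps] [t tN2 Qt]; exists (s ++ t); first by rewrite size_cat leq_add.
by move=> x [/Ps|/Qt]; rewrite mem_cat => ->; rewrite ?orbT.
Qed.

(** The coordinates are chosen one after the other. *)
Lemma atmost_tuples (L : language) (S : structure L) m (N : 'I_m -> nat)
    (P : 'I_m -> set S) : (forall j, atmost (N j) (P j)) ->
  atmost (\prod_(j < m) N j) [set x : 'I_m -> S | forall j, P j (x j)].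
Proof.
elim: m N P => [|m IHm] N P PN.
  rewrite big_ord0; exists [:: fun j : 'I_0 => False_rect _ (notF (ltn_ord j))] => // x _.
  by rewrite inE; apply/eqP/funext => -[].
rewrite big_ord_recl.
have [s sN Ps] := IHm _ (P \o lift ord0) (fun j => PN (lift ord0 j)).
pose Q y := [set vcons y w | w in [set` s]].
apply: atmostW (atmost_bigcup (Q := Q) (PN ord0) _) => [x Px|y _].
  exists (x ord0); first exact: Px.
  by exists (x \o lift ord0); [apply: Ps => j; exact: Px|exact: vcons_eta].
exists (map (vcons y) s); first by rewrite size_map.
by move=> x [w ws <-]; apply: map_f.
Qed.

(** The instances of [AlgH] used for covering, in negated form: a set of solutions
    is covered by finitely many of them when it is inconsistent with their
    negations. *)
Definition not_covered (L : language) m n k : set (formula (lang_H L) (m + k)) :=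
  [set q | exists theta N, q = Neg (@AlgH L n m k predT theta N)].

(** For each formula of [l] there are [|H| ^ n] tuples [h], each leaving at most
    [\prod_j N j] values for [x]. *)
Lemma card_covered (L : language) m n k (l : seq (formula (lang_H L) (m + k))) :
  List.Forall (@not_covered L m n k) l ->
  exists K, forall (S : structure (lang_H L)) (z : 'I_k -> S),
  finite_set [set: S] -> atmost (K * ncard (Hset (N := S)) ^ n)
    [set x : 'I_m -> S | ~ sat (Conj l) (vcat x z)].
Proof.
elim: l => [|q l IHl] lP.
  by exists 0%N => S z _; exists [::] => // x []; rewrite satConj; constructor.
have [[theta [N ->]] /IHl[K KP]] :
    not_covered n q /\ List.Forall (@not_covered L m n k) l by inversion lP.
exists (\prod_(j < m) N j + K)%N => S z finS; pose S0 := reduct S.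
pose D (h : 'I_n -> S0) := [set x : 'I_m -> S0 | forall j,
  sat (theta j) (vcons (x j) (vcat h z)) /\ sat (AtMost (N j) (theta j)) (vcat h z)].
have DN h : atmost (\prod_(j < m) N j) (D h).
  apply: (@atmost_tuples L S0 m N (fun j => [set y |
    sat (theta j) (vcons y (vcat h z)) /\ sat (AtMost (N j) (theta j)) (vcat h z)])) => j.
  have [|nN] := pselect (sat (AtMost (N j) (theta j)) (vcat h z : 'I__ -> S0)).
    by rewrite satAtMost; apply: atmostW => y [].
  by exists [::] => // y [].
have [s us sE] : exists2 s : seq S0, uniq s & [set` s] = Hset (N := S).
  by apply: finite_uniq_seq; exact: sub_finite_set finS.
have HN : atmost (size s ^ n) [set h : 'I_n -> S0 | forall i, Hset (h i)].
  rewrite -[X in (_ ^ X)%N](card_ord n) -prod_nat_const.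
  apply: (@atmost_tuples L S0 n (fun=> size s) (fun=> Hset (N := S))) => i.
  by rewrite -sE; exact/atmost_size.
have KS := KP S z finS; rewrite (ncard_uniq us sE) in KS *.
rewrite mulnDl (mulnC (\prod_(j < m) N j)%N).
apply: atmostW (atmost_setU (atmost_bigcup (Q := D) HN (fun h _ => DN h)) KS) => x.
rewrite /mkset satConj => nlx.
have [lx|nlx'] := pselect (@sat (lang_H L) S _ (Conj l) (vcat x z)); last by right.
left; have /sat_AlgH[h [Hh xh]] : @sat (lang_H L) S _ (AlgH predT theta N) (vcat x z).
  apply: contrapT => nq; apply: nlx; constructor=> //.
  by rewrite -satConj.
by exists h => // j; exact: xh.
Qed.

Section Limit.
Variables (R : realType) (I : Type) (U : set_system I) (UU : UltraFilter U).
Import Order.TTheory GRing.Theory Num.Theory.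
Import numFieldNormedType.Exports.

Lemma ultra_map (T : Type) (f : I -> T) : UltraFilter (f @ U).
Proof.
apply: (@Build_UltraFilter _ _ (fmap_proper_filter f _)) => G GG fG.
apply/seteqP; split=> // A GA.
have [//|nA] := in_ultra_setVsetC (f @^-1` A) UU.
have /filter_ex[x []] // : G (A `&` ~` A).
by apply: filterI => //; apply: fG; exact: nA.
Qed.

(** The limit exists because the values stay in a compact interval. *)
Lemma ultra_lim_le (r : I -> R) (c : R) :
  (\forall i \near U, 0 <= r i) ->
  (forall eps, 0 < eps -> \forall i \near U, r i <= c + eps) ->
  (lim ((r i)%:E @[i --> U]) <= c%:E)%E.
Proof.
move=> r0 rc; have rU := ultra_map r.
have r01 : (r @ U) `[0, c + 1]%classic.
  apply: filterS2 r0 (rc 1 ltr01) => i ri0 ric.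
  by rewrite /= in_itv /= ri0.
have := @segment_compact R 0 (c + 1); rewrite compact_ultra => /(_ _ rU r01)[p [_ rp]].
have -> : lim ((r i)%:E @[i --> U]) = p%:E.
  apply: cvg_lim => //; apply: cvg_EFin => //.
  by apply: nearW.
rewrite lee_fin leNgt; apply/negP => cp.
have h := rc ((p - c) / 2); have : 0 < (p - c) / 2 by rewrite divr_gt0 // subr_gt0.
move=> /h /(cvgr_to_le rp); lra.
Qed.

(** The factor [K] contributes [ln K / ln (h i)], which tends to [0]. *)
Lemma near_log_ratio_le (x h : I -> nat) (K n : nat) :
  (forall B, \forall i \near U, (B <= h i)%N) ->
  (\forall i \near U, (x i <= K * h i ^ n)%N) ->
  forall eps : R, 0 < eps ->
    \forall i \near U, ln (x i)%:R / ln (h i)%:R <= n%:R + eps.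
Proof.
move=> large xh eps eps0; pose K1 : R := K.+1%:R.
have K10 : 0 < K1 by rewrite ltr0n.
apply: filterS2 (large (Num.bound (expR (ln K1 / eps))).+2) xh => i hi xi.
have h2 : (2 <= h i)%N by apply: leq_trans hi.
have h0 : 0 < (h i)%:R :> R by rewrite ltr0n; apply: leq_trans h2.
have lnh0 : 0 < ln (h i)%:R :> R by rewrite ln_gt0 // ltr1n.
have lnK : ln K1 <= eps * ln (h i)%:R.
  rewrite mulrC -ler_pdivrMr // -[leLHS]expRK ler_ln ?posrE ?expR_gt0 //.
  rewrite ltW // (lt_le_trans (archi_boundP _)) ?expR_ge0 // ler_nat.
  by do 2 apply: ltnW.
rewrite ler_pdivrMr //.
have bound : ln (x i)%:R <= ln (K1 * (h i)%:R ^+ n) :> R.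
  have [->|x0] := posnP (x i).
    rewrite ln0 // ln_ge0 // -natrX -natrM ler1n muln_gt0 expn_gt0 /=.
    by rewrite (leq_trans _ h2).
  rewrite ler_ln ?posrE ?ltr0n ?mulr_gt0 ?exprn_gt0 //.
  by rewrite -natrX -natrM ler_nat (leq_trans xi) // leq_mul.
apply: le_trans bound _; rewrite lnM ?posrE ?exprn_gt0 // lnXn //.
rewrite -[ln _ *+ n]mulr_natl mulrDl; move: lnK; lra.
Qed.

End Limit.

(** * Sets of finite SU-rank are covered by powers of [H] *)

Lemma SU_ge_leq (L : language) (S : structure L) (T : set (formula L 0)) A n
    (p : set (pformula S n)) j k : (j <= k)%N -> SU_ge T A p k -> SU_ge T A p j.
Proof.
elim: j k A p => [//|j IHj] [//|k] A p jk [B [q [h [pq fk SUq]]]].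
by exists B, q; split=> //; split=> //; exact: IHj SUq.
Qed.

Section Cover.
Variables (L : language) (S : structure (lang_H L)).
Variables (T : set (formula (lang_H L) 0)).
Hypotheses (infT : infinite_set T) (satS : saturated S T).
Hypotheses (dense : Hdense S) (gen : Hgeneric S).
Local Notation S0 := (reduct S).
Local Notation H := (Hset (N := S)).
Local Notation LH := (lang_H L).
Variable M : structure L.
Hypotheses (geoM : geometric_structure M) (S_M : models S0 (theory M)).
Hypotheses (trivM : nowhere_trivial (theory M)) (infTM : infinite_set (theory M)).
Local Notation free A := (Hfree (@acl L S0) H A).

Let clP : pregeometry (@acl L S0) := acl_pregeometry (geometric_models S_M geoM).1.

Variables (m k n : nat) (phi : formula LH (m + k)) (b : 'I_k -> S0).
Hypothesis fb : free (range b).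
Hypothesis H0 : H !=set0.
Hypothesis rank_le : forall p : set (pformula S m), complete_type (S := S) (range b) p ->
  p (@PFormula LH S m k phi b) -> ~ SU_ge (S := S) T (range b) p n.+1.

(** Otherwise [x] would have a support of more than [n] elements: over [b] itself
    if all its coordinates are algebraic over [b] and [H], and over a larger base,
    for a coordinate that is not, by [generic_support]. *)
Lemma solution_algebraic (x : 'I_m -> S0) : @sat LH S _ phi (vcat x b) ->
  exists2 h : 'I_n -> S0, range h `<=` H & forall j, acl (range (vcat h b)) (x j).
Proof.
move=> phix.
have small k' (w : 'I_k' -> S0) (J : pred 'I_m) F :
    range b `<=` range w -> free (range w) ->
    is_support (@acl L S0) H (range w) [set x j | j in [set j | J j]] F ->
    (size F <= n)%N.
  move=> bw fw supp; have rk := SU_ge_support infT satS dense gen clP fw supp.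
  rewrite leqNgt; apply/negP => nF.
  apply: (rank_le (complete_type_of (S := S) (range b) x)); first by split.
  apply: (SU_ge_leq nF); apply: (SU_ge_subset (S := S) bw _ rk) => psi [par_b sol].
  by split=> //; exact: subset_trans par_b bw.
have [/existsNP[j nxj]|xH] := pselect (~ forall j, acl (range b `|` H) (x j)).
  have [l [w [F [[bw _ fw] [supp szF _]]]]] :=
    generic_support infT satS dense gen geoM S_M trivM infTM n.+1 [::] fb nxj.
  suff: (size F <= n)%N by rewrite szF ltnn.
  apply: (small _ w (pred1 j)) => //.
  rewrite [X in is_support _ _ _ X](_ : _ = [set x j]) //.
  apply/seteqP; split=> y /=; first by move=> [i /eqP -> <-].
  by move=> ->; exists j => /=.
have {}xH j : acl (range b `|` H) (x j) by move/contrapT: xH; exact.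
have [|F supp] := support_exists clP (ys := tuple_seq x) fb.
  by rewrite set_tuple_seq => _ [j _ <-].
have xE : [set` tuple_seq x] = [set x j | j in [set j | predT j]].
  by rewrite set_tuple_seq; apply/seteqP; split=> y [j _ <-]; exists j.
rewrite xE in supp; have szF := small _ b predT F (fun y => id) fb supp.
have [uF FH xF _] := supp; have [h0 Hh0] := H0.
(* A support with fewer than [n] elements is completed by [h0]. *)
exists (fun i => nth h0 F i).
  move=> _ [i _ <-]; have [iF|Fi] := ltnP i (size F); last by rewrite nth_default.
  by apply: FH; exact: mem_nth.
move=> j; apply: (cl_mono clP) (xF (x j) _); last by exists j.
rewrite range_vcat => y [?|yF]; [by right|left].
have iF : (index y F < size F)%N by rewrite index_mem.
by exists (Ordinal (leq_trans iF szF)) => //=; exact: nth_index.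
Qed.

(** By saturation finitely many algebraic formulas suffice for all solutions. *)
Lemma solutions_covered : exists2 l, List.Forall (@not_covered L m n k) l &
  forall x : 'I_m -> S0, ~ @sat LH S _ (And phi (Conj l)) (vcat x b).
Proof.
apply: contrapT => ncov; pose Gamma : set (formula LH (m + k)) :=
  phi |` @not_covered L m n k.
have [l Gl|x hx] := saturated_realizeN infT satS (v := b) (Gamma := Gamma).
  have [l' l'P l'l] : exists2 l', List.Forall (@not_covered L m n k) l' &
      forall x : 'I_m -> S0, @sat LH S _ (And phi (Conj l')) (vcat x b) ->
        @sat LH S _ (Conj l) (vcat x b).
    elim: l Gl => [|q l IHl] Gl.
      by exists [::] => // x _; rewrite satConj.
    have [Gq /IHl[l' l'P l'l]] : Gamma q /\ List.Forall Gamma l by inversion Gl.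
    have [->|nq] := Gq.
      exists l' => // x xl'; rewrite satConj; constructor; last first.
        by rewrite -satConj; exact: l'l.
      by move: xl'; rewrite satAnd => -[].
    exists (q :: l'); first by constructor.
    move=> x; rewrite satAnd => -[px]; rewrite satConj => ql'.
    have [qx l'x] : @sat LH S _ q (vcat x b) /\
        List.Forall (fun q => @sat LH S _ q (vcat x b)) l' by inversion ql'.
    rewrite satConj; constructor=> //; rewrite -satConj; apply: l'l.
    by rewrite satAnd satConj.
  apply: contrapT => nx; apply: ncov; exists l' => // x /l'l lx.
  by apply: nx; exists x.
have [h hH xh] := solution_algebraic (hx phi (or_introl erefl)).
have alg j := (acl_rangeP (vcat h b) (x j)).1 (xh j).
pose theta j := sval (cid (alg j)).
pose N j := sval (cid (svalP (cid (alg j)))).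
have := hx (Neg (@AlgH L n m k predT theta N)); rewrite satNeg; apply.
  by right; exists theta, N.
apply/sat_AlgH; exists h; split=> [i|j _]; first by apply: hH; exists i.
exact: (svalP (cid (svalP (cid (alg j))))).
Qed.

End Cover.

(** Density applied to a formula that always holds. *)
Lemma Hdense_infinite (L : language) (S : structure (lang_H L)) :
  Hdense S -> infinite_set [set: S] -> infinite_set (Hset (N := S)).
Proof.
move=> dense infS finH; have [K h] := dense 0%N (Neg (Falsum L 1)).
have [N HN] := (finite_atmost _).1 finH; have [x0] := dom_nonempty S.
have := h N (fun=> x0); rewrite satImp !satNeg sat_lift !satAtMost; apply.
  move=> SK; apply: infS; apply/finite_atmost; exists K.
  by apply: atmostW SK => x _; rewrite /mkset satNeg.
by apply: atmostW HN => x; rewrite /mkset satAnd sat_InH vcons0 => -[].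
Qed.

Import Order.TTheory GRing.Theory Num.Theory.

Theorem lemma4p1 (R : realType) (L : language) (C : structure L -> Prop)
  (C_asymptotic : asymptotic_class_1dim R C)
  (I : Type) (U : set_system I) (UU : UltraFilter U)
  (M_ : I -> structure L) (M_in_C : forall i, C (M_ i))
  (H_ : forall i, set (M_ i)) :
  let M := ultraproduct UU M_ in
  let T := theory M in
  let MH_ i := expandH (H_ i) in
  let MH := ultraproduct UU MH_ in
  infinite_set [set: M] ->
  nowhere_trivial T ->
  H_structure MH ->
  delta U R (fun i => ncard (H_ i)) (fun i => ncard [set: M_ i]) = 0%E ->
  forall (m k : nat) (phi : formula (lang_H L) (m + k))
    (c_ : 'I_k -> forall i, M_ i),
  let c : 'I_k -> MH := fun j => uclass UU (c_ j) in
  let X : set ('I_m -> MH) := defset phi c in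
  let X_ i : set ('I_m -> M_ i) :=
    defset (S := MH_ i) phi (fun j => c_ j i) in
  X !=set0 ->
  H_independent c ->
  forall (S : structure (lang_H L)) (e : MH -> S),
  models S (Tind T) -> saturated S (Tind T) -> elementary e ->
  forall n : nat,
  SU_def R (Tind T) (range (e \o c)) (PFormula phi (e \o c)) = n%:R%:E ->
  (delta U R (fun i => ncard (X_ i)) (fun i => ncard (H_ i)) <= n%:R%:E)%E.
Proof.
move=> M T MH_ MH infM trivM MH_H _ m k phi c_ c X X_ _ c_ind S e S_Tind S_sat eE n SUn.
have geoM : geometric_structure M.
  by apply: (geometric_ultraproduct (UU := UU) C_asymptotic M_in_C); exact: infM.
have geoMH : geometric_structure (reduct MH) by [].
have infT : infinite_set T by apply: infinite_theory => p taut v.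
have infTind : infinite_set (Tind T) by apply: infinite_theory => p taut N _ _ v.
have S_M : models (reduct S) (theory M) by exact: reduct_models eE.
have dense := elementary_Hdense eE (H_structure_dense MH_H geoMH).
have gen := elementary_Hgeneric eE (H_structure_generic MH_H geoMH).
have fc := perp_Hfree (acl_pregeometry geoMH.1) MH_H.1 c_ind.
have fec := elementary_Hfree eE fc.
have infH : infinite_set (Hset (N := MH)).
  exact: (Hdense_infinite (H_structure_dense MH_H geoMH) infM).
have HS0 : Hset (N := S) !=set0.
  have [h Hh] : Hset (N := MH) !=set0.
    by apply/set0P/eqP => H0; apply: infH; rewrite H0.
  exists (e h).
  by have [/(_ Hh)] := eE _ (InH L ord0) (fun _ : 'I_1 => h).
have [l lP cov] : exists2 l, List.Forall (@not_covered L m n k) l &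
    forall x : 'I_m -> S, ~ sat (And phi (Conj l)) (vcat x (e \o c)).
  apply: (solutions_covered infTind S_sat dense gen geoM S_M trivM infT fec HS0).
  move=> p cp pphi SUp; have : (n.+1%:R%:E <= n%:R%:E :> \bar R)%E.
    rewrite -SUn; apply: (@le_trans _ _ (SU R (Tind T) (range (e \o c)) p)).
      by apply: ereal_sup_ubound; exists n.+1.
    by apply: ereal_sup_ubound; exists p.
  by rewrite lee_fin ler_nat ltnn.
have [K KP] := card_covered lP.
have finM i : finite_set [set: M_ i] by exact: C_asymptotic.1 (M_in_C i).
have H_large B : \forall i \near U, (B <= ncard (H_ i))%N.
  exact: (@ultraproduct_large _ _ _ UU MH_ (InH L ord0) finM infH B).
have X_small : \forall i \near U, (ncard (X_ i) <= K * ncard (H_ i) ^ n)%N.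
  pose q : formula (lang_H L) k := Neg (ExN (And phi (Conj l))).
  have /(sat_ultraproduct UU (S_ := MH_) q c_) : sat q c.
    apply: (eE _ q c).2; rewrite /q satNeg satExN => -[x]; exact: cov.
  apply: filterS => i; rewrite /q satNeg satExN => covi.
  have := KP (MH_ i) (fun j => c_ j i) (finM i).
  have Xl : X_ i `<=` [set x |
      ~ @sat (lang_H L) (MH_ i) _ (Conj l) (vcat x (fun j => c_ j i))].
    by move=> x phix lx; apply: covi; exists x; rewrite satAnd.
  move=> /(atmostW Xl) XK.
  have [|s us sE] := finite_uniq_seq (A := X_ i).
    by apply/finite_atmost; eexists; exact: XK.
  by rewrite (ncard_uniq us sE); move: XK; rewrite -sE => /(atmost_size _ us).
apply: ultra_lim_le; last exact: near_log_ratio_le H_large X_small.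
apply: filterS (H_large 1%N) => i Hi; apply: divr_ge0.
  have [->|X0] := posnP (ncard (X_ i)); first by rewrite ln0.
  by rewrite ln_ge0 // ler1n.
by rewrite ln_ge0 // ler1n.
Qed.
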